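(* Let $Y_1,Y_2$ be independent gamma random variables, $Y_i$ having known shape $\alpha_i>0$ and rate $\alpha_i/\kappa_i$ with unknown $\kappa_i>0$, and put $\zeta=\kappa_2/\kappa_1$. For $\alpha\in(0,1)$ let $F_{\alpha,d_1,d_2}$ denote the $(1-\alpha)$th quantile of the $F$-distribution with $(d_1,d_2)$ degrees of freedom, $V=Y_2/Y_1$, and $Z_\alpha=V\,F_{\alpha,2\alpha_1,2\alpha_2}$. Let $\nu\in\mathbb R$ and let $\mathscr T_\nu$ be the estimator defined in the context, used as an estimator of $\tau=(\kappa_1-\kappa_2)^{-1}$, with absolute relative bias $\operatorname{ARB}\mathscr T_\nu$. If $-\alpha_2<\nu<\alpha_1$, then $$\operatorname{CI}_\alpha(\operatorname{ARB}\mathscr T_\nu)=\begin{cases}(0,Z_{1-\alpha}^\nu],&\nu<0\\(0,Z_\alpha^\nu],&\nu>0\end{cases}$$ is an upper bound confidence set for $\operatorname{ARB}\mathscr T_\nu$ with coverage probability $1-\alpha$, i.e. $\mathsf P\bigl(\operatorname{CI}_\alpha(\operatorname{ARB}\mathscr T_\nu)\ni\operatorname{ARB}\mathscr T_\nu\bigr)=1-\alpha$.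
   Context: $(s)_w=\Gamma(s+w)/\Gamma(s)$ and $F(a,b;c;x)={}_2F_1(a,b;c;x)$. The estimator is $$\mathscr T_\nu=\frac{\alpha_1-1}{\alpha_1Y_1}\Bigl(F(1,2-\alpha_1;\alpha_2;-Z)-\frac{Z^\nu}{(\alpha_1-1)_{-\nu}(\alpha_2)_\nu}F(1,2-\alpha_1+\nu;\alpha_2+\nu;-Z)\Bigr),\qquad Z=\frac{\alpha_2Y_2}{\alpha_1Y_1},$$ with removable singularities filled by continuity. The absolute relative bias is $\operatorname{ARB}\mathscr T_\nu=|(\mathsf E\mathscr T_\nu-\tau)/\tau|$. For $-\alpha_2<\nu<\alpha_1$ one has $\mathsf E\mathscr T_\nu=(1-\zeta^\nu)/(\kappa_1-\kappa_2)$, so $\operatorname{ARB}\mathscr T_\nu=\zeta^\nu$.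
   Formalization: The condition α₁+α₂>1 is added: for α₁+α₂≤1 the estimator, homogeneous of degree −1, has E|T_ν|=∞, so its absolute relative bias is undefined; also κ₁≠κ₂ (so that τ exists) and ν≠0 are made explicit. *)

(* Defs.v *)
From HB Require Import structures.
From mathcomp Require Import all_boot all_order all_algebra.
From mathcomp Require Import all_classical all_reals all_analysis.

Set Implicit Arguments.
Unset Strict Implicit.
Unset Printing Implicit Defensive.

Import Order.TTheory GRing.Theory Num.Theory.
Import numFieldNormedType.Exports.

Local Open Scope classical_set_scope.
Local Open Scope ring_scope.

Section SpecialFunctions.
Context {R : realType}.
Implicit Types a b c s w x : R.

Definition Gamma_pos x : R :=
  \int[lebesgue_measure]_(t in `]0, +oo[) (t `^ (x - 1) * expR (- t)).

(* Euler's integral for x > 0, continued to x <= 0 by Gamma(x + 1) = x Gamma(x).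
   At the poles 0, -1, -2, ... the value is 0, so that (Gamma x)^-1 is
   everywhere the entire function 1 / Gamma. *)
Definition Gamma x : R :=
  if 0 < x then Gamma_pos x
  else let n := (Num.truncn (- x)).+1 in
       Gamma_pos (x + n%:R) / \prod_(i < n) (x + i%:R).

Definition pochhammer s w : R := Gamma (s + w) / Gamma s.

(* The Pochhammer symbol (s)_n with n a natural number, in the form that also
   makes sense when s is a pole of Gamma. *)
Definition rising s (n : nat) : R := \prod_(i < n) (s + i%:R).

Definition gauss_series a b c x : R :=
  limn (series (fun n =>
    rising a n * rising b n / (rising c n * n`!%:R) * x ^+ n)).

(* 2F1(a, b; c; x) for x < 1: Gauss's series for -1 < x < 1 and, for x <= -1,
   its analytic continuation along the negative real axis, which Pfaff's
   transformation 2F1(a, b; c; x) = (1 - x)^(-a) 2F1(a, c - b; c; x / (x - 1))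
   expresses by the series at a point of [1/2, 1). *)
Definition hyp2F1 a b c x : R :=
  if - 1 < x then gauss_series a b c x
  else (1 - x) `^ (- a) * gauss_series a (c - b) c (x / (x - 1)).

End SpecialFunctions.

Section Distributions.
Context {R : realType}.

Definition gamma_pdf (shape rate x : R) : R :=
  if 0 < x
  then rate `^ shape / Gamma shape * x `^ (shape - 1) * expR (- (rate * x))
  else 0.

Definition has_gamma_dist d (T : measurableType d) (P : probability T R)
    (X : {RV P >-> R}) (shape rate : R) : Prop :=
  forall A : set R, measurable A ->
    distribution P X A =
      (\int[lebesgue_measure]_(x in A) (gamma_pdf shape rate x)%:E)%E.

Definition independent_RV d (T : measurableType d) (P : probability T R)
    (X Y : {RV P >-> R}) : Prop :=
  forall A B : set R, measurable A -> measurable B ->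
    P ((X @^-1` A) `&` (Y @^-1` B)) = (P (X @^-1` A) * P (Y @^-1` B))%E.

Definition fisher_pdf (d1 d2 x : R) : R :=
  if 0 < x
  then Gamma ((d1 + d2) / 2) / (Gamma (d1 / 2) * Gamma (d2 / 2))
       * (d1 / d2) `^ (d1 / 2) * x `^ (d1 / 2 - 1)
       * (1 + d1 / d2 * x) `^ (- ((d1 + d2) / 2))
  else 0.

Definition fisher_cdf (d1 d2 x : R) : R :=
  \int[lebesgue_measure]_(t in `]-oo, x]) fisher_pdf d1 d2 t.

Definition fisher_quantile (d1 d2 p : R) : R :=
  inf [set x | p <= fisher_cdf d1 d2 x].

Definition F_upper (alpha d1 d2 : R) : R := fisher_quantile d1 d2 (1 - alpha).

End Distributions.

Section Estimator.
Context {R : realType}.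

Definition T_formula (alpha1 alpha2 nu y1 y2 : R) : R :=
  let Z := (alpha2 * y2) / (alpha1 * y1) in
  (alpha1 - 1) / (alpha1 * y1) *
  (hyp2F1 1 (2 - alpha1) alpha2 (- Z)
   - Z `^ nu / (pochhammer (alpha1 - 1) (- nu) * pochhammer alpha2 nu)
     * hyp2F1 1 (2 - alpha1 + nu) (alpha2 + nu) (- Z)).

(* For alpha1, alpha2 > 0 and - alpha2 < nu < alpha1 the formula is singular
   exactly when Gamma(alpha1 - 1) or Gamma(alpha1 - 1 - nu) has a pole, i.e. for
   alpha1 = 1 or alpha1 = 1 + nu; there T_stat is its continuous extension in
   the parameter alpha1. *)
Definition T_stat (alpha1 alpha2 nu y1 y2 : R) : R :=
  if (alpha1 == 1) || (alpha1 == 1 + nu)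
  then lim (T_formula a alpha2 nu y1 y2 @[a --> alpha1^'])
  else T_formula alpha1 alpha2 nu y1 y2.

(* Meaningful only if the expectation of X is finite and tau != 0.  T_stat is
   homogeneous of degree -1 in (y1, y2), so that under gamma laws it is
   integrable at the origin only if 1 < alpha1 + alpha2. *)
Definition ARB d (T : measurableType d) (P : probability T R)
    (X : T -> R) (tau : R) : R :=
  `| (fine ('E_P[X])%E - tau) / tau |.

Definition Z_stat (alpha alpha1 alpha2 y1 y2 : R) : R :=
  y2 / y1 * F_upper alpha (2 * alpha1) (2 * alpha2).

(* Only used for nu != 0. *)
Definition CI_ARB (alpha alpha1 alpha2 nu y1 y2 : R) : set R :=
  if nu < 0
  then `]0, Z_stat (1 - alpha) alpha1 alpha2 y1 y2 `^ nu]%classic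
  else `]0, Z_stat alpha alpha1 alpha2 y1 y2 `^ nu]%classic.

End Estimator.

(* Main.v *)
(** Write p = alpha1 / kappa1, q = alpha1 / kappa2 and m = alpha1 + alpha2 - 1.
A hypergeometric function with numerator parameter 1 solves a first order
linear equation, whence
  (1 + z) 2F1(1, b; c; -z)
    = 1 + (c - b) z^(1 - c) (1 + z)^(c - b) int_0^z t^(c - 1) (1 + t)^(b - c - 1) dt.
The ratio Y2 / Y1 has a beta prime density, so each of the two terms of the
estimator has an expectation of the form
int z^(c - 1) (p + q z)^(- m) 2F1(1, 1 + c - m; c; -z) dz, and exchanging the two
integrations turns it into a difference of beta integrals, a multiple of
q^(1 - a) - p^(1 - a) with a = m + 1 - c. The contributions of q^(1 - a) cancel
between the two terms, which leaves E T = (1 - zeta^nu) / (kappa1 - kappa2) and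
ARB = zeta^nu. Finally zeta Y1 / Y2 follows the F-distribution with
(2 alpha1, 2 alpha2) degrees of freedom, which is atomless: the event
zeta^nu <= Z^nu says that this ratio lies below its (1 - alpha)th quantile if
nu > 0, above its alpha-th quantile if nu < 0. *)

Require Import Defs.
From HB Require Import structures.
From mathcomp Require Import all_boot all_order all_algebra.
From mathcomp Require Import all_classical all_reals all_analysis.
From mathcomp Require Import measurable_realfun.
From mathcomp Require Import ring lra.
Import Order.TTheory GRing.Theory Num.Theory.
Import numFieldNormedType.Exports.
Local Open Scope classical_set_scope.
Local Open Scope ring_scope.
Set Implicit Arguments.
Unset Strict Implicit.
Unset Printing Implicit Defensive.

(** * Integration *)

(** Both hypergeometric terms have 1 + c - b = m, so a single computation, with z^e inserted and e =
    0 or e = nu, serves both. Two obstacles shape it. The exchanges of integrals are made by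
    Tonelli, but m - 1 and p - q may be negative: each mean is split into two integrals of
    nonnegative functions, which are shown to be finite before they are combined with signs. The
    final difference, on the contrary, must not be split, because its two beta integrals diverge
    separately when a <= 1; it is turned into an integral over the interval between p and q. The
    other obstacle is the singular parameters. At a = 1 nothing may be divided by a - 1, so the
    means are computed up to that factor, and the coefficients of the estimator supply it once the
    Gamma function is taken at positive arguments only. The same form of the coefficients shows that
    the estimator is continuous in alpha1 across its removable singularities. At m = 1 the kernel
    term drops out. *)

Section IntegrationTools.
Local Open Scope ereal_scope.

(** * Integrals against a measure given by a density *)

Section Density.
Context d (T : measurableType d) (R : realType).
Variables (mu nu : {measure set T -> \bar R}) (p : T -> R).
Hypotheses (mp : measurable_fun [set: T] p) (p0 : forall x, (0 <= p x)%R).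
Hypothesis nuE : forall A, measurable A -> nu A = \int[mu]_(x in A) (p x)%:E.
Import HBNNSimple.

Let integral_density_nnsfun (f : {nnsfun T >-> R}) :
  \int[nu]_x (f x)%:E = \int[mu]_x ((f x)%:E * (p x)%:E).
Proof.
under [LHS]eq_integral do rewrite fimfunE -fsumEFin//.
rewrite [LHS]ge0_integral_fsum//; last 2 first.
  - by move=> r; exact/measurable_EFinP/measurableT_comp.
  - by move=> n x _; rewrite EFinM nnfun_muleindic_ge0.
under [RHS]eq_integral.
  move=> x xD; rewrite fimfunE -fsumEFin// ge0_mule_fsuml; last first.
    by move=> r; rewrite EFinM nnfun_muleindic_ge0.
  over.
rewrite [RHS]ge0_integral_fsum//; last 2 first.
  - move=> r; apply: emeasurable_funM; last exact/measurable_EFinP.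
    by apply/measurable_EFinP; exact: measurableT_comp.
  - by move=> n x _; rewrite mule_ge0 ?lee_fin// -lee_fin EFinM nnfun_muleindic_ge0.
apply: eq_fsbigr => r _.
rewrite integralZl_indic_nnsfun//= integral_indic// setIT nuE//.
have [r0|r0] := leP 0%R r; last first.
  rewrite (preimage_nnfun0 f r0) integral_set0 mule0 integral0_eq// => x _.
  by rewrite indicE in_set0 mulr0 mul0e.
rewrite integral_mkcond -ge0_integralZl//; last 2 first.
  - exact/(measurable_restrictT _ _).1/measurable_EFinP/measurable_funTS.
  - by move=> x _; apply: erestrict_ge0 => y _; rewrite lee_fin.
apply: eq_integral => x _; rewrite patchE indicE; case: ifPn => _.
  by rewrite mulr1.
by rewrite mulr0 mul0e mule0.
Qed.

(** The laws of the data are specified by their values on sets; simple functions and monotone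
    convergence carry the density over to integrals. *)
Lemma ge0_integral_density (f : T -> \bar R) :
  measurable_fun setT f -> (forall x, 0 <= f x) ->
  \int[nu]_x f x = \int[mu]_x (f x * (p x)%:E).
Proof.
move=> mf f0.
pose f_ := nnsfun_approx measurableT mf.
have cf x : (f_ n x)%:E @[n --> \oo] --> f x by exact: cvg_nnsfun_approx.
transitivity (lim (\int[nu]_x (f_ n x)%:E @[n --> \oo])).
  rewrite -monotone_convergence//=.
  - by apply: eq_integral => x _; apply/esym/cvg_lim => //; exact: cf.
  - by move=> n; exact/measurable_EFinP/measurable_funTS.
  - by move=> n ? _; rewrite lee_fin.
  - by move=> ? _ ? ? mn; rewrite lee_fin; exact/lefP/nd_nnsfun_approx.
rewrite (_ : (fun n => \int[nu]_x (f_ n x)%:E) =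
    fun n => \int[mu]_x ((f_ n x)%:E * (p x)%:E)); last first.
  by apply/funext => n; exact: integral_density_nnsfun.
rewrite -monotone_convergence//=.
- apply: eq_integral => x _; apply/cvg_lim => //.
  by apply: cvgeZr => //; exact: cf.
- by move=> n; apply: emeasurable_funM; exact/measurable_EFinP/measurable_funTS.
- by move=> n x _; rewrite mule_ge0 ?lee_fin.
- move=> x _ m n mn; rewrite lee_wpmul2r ?lee_fin//.
  exact/lefP/nd_nnsfun_approx.
Unshelve. all: by end_near. Qed.

End Density.

(** * Integrals of functions that agree off a null set *)

Section EqAe.
Context d (T : measurableType d) (R : realType).
Variables (mu : {measure set T -> \bar R}) (E : set T).
Hypotheses (mE : measurable E) (muE : mu (~` E) = 0).
Import HBNNSimple.

Let ge0_le_integral_ae (f g : T -> \bar R) :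
  (forall x, 0 <= f x) -> (forall x, 0 <= g x) -> (forall x, E x -> f x = g x) ->
  \int[mu]_x f x <= \int[mu]_x g x.
Proof.
move=> f0 g0 fg; rewrite ge0_integralTE// [leRHS]ge0_integralTE//.
apply: ge_ereal_sup => _ [h /= hf <-].
(* The integral of [f] is a supremum over simple functions [h <= f]. Cutting [h] down to [E] keeps
   its integral and puts it below [g], which equals [f] on [E] and is nonnegative elsewhere. *)
pose h' := proj_nnsfun h mE.
apply: ereal_sup_ubound; exists h' => /=.
  move=> x; rewrite /= /mindic indicE; case: (boolP (x \in E)) => xE.
    by rewrite mulr1 -fg//; exact/set_mem.
  by rewrite mulr0.
rewrite -!integralT_nnsfun; apply: ge0_ae_eq_integral => //.
- exact/measurable_EFinP.
- exact/measurable_EFinP.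
- by move=> x _; rewrite lee_fin.
- by move=> x _; rewrite lee_fin.
exists (~` E); split => //; first exact: measurableC.
move=> x /= h1 h2; apply: h1 => _; rewrite /mindic indicE mem_set// mulr1//.
Qed.

(* The two functions need not be measurable outside of [E]. *)
Lemma eq_integral_ae (f g : T -> \bar R) : (forall x, E x -> f x = g x) ->
  \int[mu]_x f x = \int[mu]_x g x.
Proof.
move=> fg; rewrite integralE [RHS]integralE; congr (_ - _); apply/eqP;
  rewrite eq_le; apply/andP; split; apply: ge0_le_integral_ae => // x Ex;
  by rewrite ?funeposE ?funenegE fg.
Qed.
End EqAe.

(** * Tonelli's theorem on a rectangle *)

Section TonelliOn.
Context d1 d2 (T1 : measurableType d1) (T2 : measurableType d2) (R : realType).
Variables (m1 : {sigma_finite_measure set T1 -> \bar R})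
          (m2 : {sigma_finite_measure set T2 -> \bar R}).
Variables (A : set T1) (B : set T2) (f : T1 -> T2 -> \bar R).
Hypotheses (mA : measurable A) (mB : measurable B).
Hypothesis mf : measurable_fun (A `*` B) (fun z : T1 * T2 => f z.1 z.2).
Hypothesis f0 : forall x y, A x -> B y -> 0 <= f x y.

(** Extension by zero turns a function controlled only on the rectangle into one that is measurable
    and nonnegative everywhere. *)
Let g := (fun z : T1 * T2 => f z.1 z.2) \_ (A `*` B).

Let mg : measurable_fun setT g.
Proof. by apply/(measurable_restrictT _ _).1 => //; exact: measurableX. Qed.

Let g0 z : 0 <= g z.
Proof. by apply: erestrict_ge0 => -[x y] [/= Ax By]; exact: f0. Qed.

Let gE x y : g (x, y) = ((fun x => (f x \_ B) y) \_ A) x.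
Proof.
rewrite /g !patchE /=; case: ifPn => [/set_mem [/= Ax By]|].
  by rewrite !mem_set.
move=> /negP nAB; case: ifPn => // /set_mem Ax; case: ifPn => // /set_mem By.
by exfalso; apply: nAB; apply/mem_set.
Qed.

Lemma tonelli_on :
  \int[m1]_(x in A) \int[m2]_(y in B) f x y =
  \int[m2]_(y in B) \int[m1]_(x in A) f x y.
Proof.
transitivity (\int[m1]_x \int[m2]_y g (x, y)).
  rewrite integral_mkcond; apply: eq_integral => x _; rewrite patchE.
  case: ifPn => xA.
    rewrite integral_mkcond; apply: eq_integral => y _.
    by rewrite gE [in RHS]patchE xA.
  by rewrite integral0_eq// => y _; rewrite gE patchE (negbTE xA).
rewrite (fubini_tonelli _ mg g0) [RHS]integral_mkcond.
apply: eq_integral => y _; rewrite patchE; case: ifPn => yB.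
  rewrite [RHS]integral_mkcond; apply: eq_integral => x _.
  by rewrite gE !patchE; case: ifPn => // _; rewrite yB.
rewrite integral0_eq// => x _; rewrite gE !patchE; case: ifPn => // _.
by rewrite (negbTE yB).
Qed.

End TonelliOn.

(** * Scaling, and the fundamental theorem of calculus next to 0 *)

Section Lebesgue.
Context (R : realType).
Local Notation mu := (@lebesgue_measure R).
Implicit Types (f F : R -> R) (c z : R).

Let scale c (x : measurableTypeR R) : measurableTypeR R := (c * x)%R.

Let measurable_scale c : measurable_fun [set: measurableTypeR R] (scale c).
Proof. exact: mulrl_measurable. Qed.

Let scaled_measure c : {measure set (measurableTypeR R) -> \bar R}.
Proof.
pose mixin := isMeasurableFun.Build _ _ _ _ _ (measurable_scale c).
pose pack : {mfun _ >-> _} := HB.pack (scale c) mixin.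
exact: (pushforward mu pack).
Defined.

(** Lebesgue measure is determined by its values on half-open intervals, and the preimage of []a,
    b]] under x -> c x is []a / c, b / c]]. *)
Let lebesgue_measure_scale c : (0 < c)%R -> forall A : set (measurableTypeR R),
  measurable A -> mu A = c%:E * scaled_measure c A.
Proof.
move=> c0.
pose nu : {measure set (measurableTypeR R) -> \bar R} :=
  mscale (NngNum (ltW c0)) (scaled_measure c).
move=> A mA; rewrite (@lebesgue_measure_unique _ nu)//.
move=> _ [[a b]] _ <-; rewrite /nu /= /mscale /= /pushforward.
rewrite (_ : scale c @^-1` _ = `](a / c)%R, (b / c)%R]%classic); last first.
  apply/seteqP; split=> x /=; rewrite !in_itv/= ltr_pdivrMr// ler_pdivlMr//;
  by rewrite /scale ![(x * c)%R]mulrC.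
rewrite !lebesgue_measure_itv /= !lte_fin ltr_pM2r ?invr_gt0//.
case: ifPn => // _; last by rewrite mule0.
rewrite -!EFinB -EFinM; congr EFin.
by field; rewrite gt_eqF.
Qed.

Lemma ge0_integral_scale c (f : R -> \bar R) : (0 < c)%R ->
  measurable_fun (`]0%R, +oo[%classic : set R) f -> (forall x, (0 < x)%R -> 0 <= f x) ->
  \int[mu]_(x in `]0%R, +oo[) f x =
  c%:E * \int[mu]_(x in `]0%R, +oo[) f (c * x)%R.
Proof.
move=> c0 mf f0.
have f0' x : (`]0%R, +oo[%classic : set R) x -> 0 <= f x.
  by rewrite /= in_itv/= andbT; exact: f0.
rewrite [in RHS](_ : `]0%R, +oo[%classic = scale c @^-1` `]0%R, +oo[); last first.
  by apply/seteqP; split => x /=; rewrite !in_itv/= !andbT /scale pmulr_rgt0.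
rewrite -(ge0_integral_pushforward (measurable_scale c) _ _ mf)//; last first.
  by move=> x /set_mem; exact: f0'.
rewrite -(ge0_integral_mscale (scaled_measure c) _ (NngNum (ltW c0)))//.
apply: eq_measure_integral => A mA _.
exact: lebesgue_measure_scale.
Qed.

(** The integrands met below are powers that may blow up at 0. The fundamental theorem is applied on
    segments that exhaust []0, z]], and the nonnegativity of [f] gives the limit of the
    integrals. *)
Lemma ge0_FTC_at0 (f F : R -> R) z : (0 < z)%R ->
  (forall x, (0 < x)%R -> (x <= z)%R -> {for x, continuous f}) ->
  (forall x, (0 < x)%R -> (x <= z)%R -> 0 <= f x)%R ->
  (forall x, (0 < x)%R -> (x <= z)%R -> is_derive x 1%R F (f x)) ->
  F x @[x --> 0^'+]%R --> 0%R ->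
  \int[mu]_(x in `]0%R, z]) (f x)%:E = (F z)%:E.
Proof.
move=> z0 cf f0 dF F0.
(* The denominator starts at 2, which keeps every [e n] strictly below [z]. *)
pose e n : R := (z / n.+2%:R)%R.
have e0 n : (0 < e n)%R by rewrite divr_gt0.
have ez n : (e n < z)%R by rewrite ltr_pdivrMr// ltr_pMr// ltr1n.
have ecvg : e n @[n --> \oo] --> 0%R.
  rewrite -(mulr0 z); apply: cvgM; first exact: cvg_cst.
  by have := @cvg_harmonic R; rewrite -(cvg_shiftn 1)/=; under eq_fun do rewrite addn1.
have itvE : \bigcup_n `[e n, z]%classic = `]0%R, z]%classic.
  apply/seteqP; split => x /=.
    move=> [n _] /=; rewrite !in_itv/= => /andP[ex ->].
    by rewrite (lt_le_trans (e0 n) ex).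
  rewrite in_itv/= => /andP[x0 xz].
  have /(_ _ x0)[n _ H] : forall x : R, (0 < x)%R -> \forall n \near \oo, (e n < x)%R.
    by move=> y y0; exact: (cvgr_lt _ ecvg).
  exists n => //=; rewrite in_itv/= xz andbT; apply/ltW/(H n)/leqnn.
have cfw n : {within `[e n, z], continuous f}.
  apply: continuous_in_subspaceT => x /set_mem /=; rewrite in_itv/= => /andP[ex xz].
  by apply: cf => //; exact: lt_le_trans ex.
have cvg1 : \int[mu]_(x in `[e n, z]) (f x)%:E @[n --> \oo] -->
    \int[mu]_(x in `]0%R, z]) (f x)%:E.
  rewrite -itvE; apply: ge0_nondecreasing_set_cvg_integral => //=.
  - move=> m n mn; apply/subsetPset => x /=; rewrite !in_itv/= => /andP[ex ->].
    rewrite andbT (le_trans _ ex)// ler_pM2l// lef_pV2 ?posrE//.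
    by rewrite ler_nat.
  - move=> n; apply/measurable_EFinP; apply: subspace_continuous_measurable_fun => //.
  - move=> n x; rewrite in_itv/= => /andP[ex xz]; rewrite lee_fin f0//.
    exact: lt_le_trans ex.
have intE n : \int[mu]_(x in `[e n, z]) (f x)%:E = (F z - F (e n))%:E.
  rewrite (continuous_FTC2 (ez n) (cfw n) (F := F))//.
  - have cF x : (0 < x)%R -> (x <= z)%R -> {for x, continuous F}.
      move=> x0 xz; apply: differentiable_continuous; apply/derivable1_diffP.
      by have [] := dF _ x0 xz.
    split.
    + move=> x; rewrite in_itv/= => /andP[ex xz]; apply: ex_derive.
      by apply: dF; [exact: lt_trans ex|exact: ltW].
    + by apply: cvg_at_right_filter; apply: cF => //; exact: ltW.
    + by apply: cvg_at_left_filter; apply: cF.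
  - move=> x; rewrite in_itv/= => /andP[ex xz]; rewrite derive1E.
    by apply: derive_val; apply: dF; [exact: lt_trans ex|exact: ltW].
have cvg2 : \int[mu]_(x in `[e n, z]) (f x)%:E @[n --> \oo] --> (F z)%:E.
  under eq_fun do rewrite intE.
  apply: cvg_EFin; first by near=> n.
  rewrite -[X in _ --> X]subr0; apply: cvgB; first exact: cvg_cst.
  by move/cvg_at_rightP : F0; apply; split.
exact: (cvg_unique _ cvg1 cvg2).
Unshelve. all: by end_near. Qed.

End Lebesgue.
End IntegrationTools.

(** * The Gamma function *)

Section GammaFunction.
Context {R : realType}.
Local Notation mu := (@lebesgue_measure R).
Local Notation Rp := (`]0%R, +oo[%classic : set R).
Implicit Types a c r s t u x y z : R.

Lemma gt0_powRD x y z : 0 < x -> x `^ (y + z) = x `^ y * x `^ z.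
Proof. by move=> x0; apply: powRD; apply/implyP => _; rewrite gt_eqF. Qed.

(** Passes between a domain of integration and a condition in the integrand; the latter form is what
    an exchange of integrals over a triangle needs. *)
Lemma integral_if (D E : set R) (b : R -> bool) (g : R -> R) :
  (forall x, E x <-> D x /\ b x) ->
  (\int[mu]_(x in D) (if b x then g x else 0)%:E = \int[mu]_(x in E) (g x)%:E)%E.
Proof.
move=> DE; rewrite integral_mkcond [RHS]integral_mkcond.
apply: eq_integral => x _; rewrite !patchE.
case: (boolP (x \in D)) => [/set_mem Dx|xD];
  case: (boolP (x \in E)) => [/set_mem Ex|xE] //.
- by move: (DE x).1 => /(_ Ex)[_ ->].
- by case: ifPn => // bx; case/negP: xE; apply/mem_set/DE.
- by case/negP: xD; apply/mem_set; have [] := (DE x).1 Ex.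
Qed.

Lemma cvg_powR (T : Type) (F : set_system T) {FF : Filter F} (f : T -> R) (l e : R) :
  0 < l -> f x @[x --> F] --> l -> f x `^ e @[x --> F] --> l `^ e.
Proof.
move=> l0 fl; apply: (@continuous_cvg _ _ _ _ _ _ (fun x => x `^ e)) => //.
apply/differentiable_continuous/derivable1_diffP.
by apply: derivable_powR; rewrite in_itv/= l0.
Qed.

Lemma cvg_powR2 (T : Type) (F : set_system T) {FF : Filter F} (f g : T -> R) (l e : R) :
  0 < l -> f x @[x --> F] --> l -> g x @[x --> F] --> e -> f x `^ g x @[x --> F] --> l `^ e.
Proof.
move=> l0 fl ge.
have : expR (g x * ln (f x)) @[x --> F] --> expR (e * ln l).
  apply: continuous_cvg; first exact: continuous_expR.
  by apply: cvgM => //; apply: continuous_cvg => //; exact: continuous_ln.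
rewrite {2}/powR gt_eqF//; apply: cvg_trans; apply: near_eq_cvg; near=> x.
suff fx0 : 0 < f x by rewrite /powR gt_eqF.
by near: x; apply: (cvgr_gt l).
Unshelve. all: by end_near. Qed.

Lemma ge0_RintegralZl (D : set R) (k : R) (f : R -> R) :
  measurable D -> measurable_fun D f -> (forall x, D x -> 0 <= f x) -> 0 <= k ->
  (\int[mu]_(x in D) (k * f x)%:E = k%:E * \int[mu]_(x in D) (f x)%:E)%E.
Proof.
move=> mD mf f0 k0; rewrite -ge0_integralZl//; exact/measurable_EFinP.
Qed.

Lemma integral_powR_at0 c z : 0 < c -> 0 < z ->
  (\int[mu]_(t in `]0%R, z]) (t `^ (c - 1))%:E = (z `^ c / c)%:E)%E.
Proof.
move=> c0 z0.
apply: (@ge0_FTC_at0 _ _ (fun t => t `^ c / c)) => //.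
- move=> x x0 _; apply: differentiable_continuous; apply/derivable1_diffP.
  by apply: derivable_powR; rewrite in_itv/= x0.
- by move=> x _ _; exact: powR_ge0.
- move=> x x0 _.
  have -> : (fun t => t `^ c / c) = c^-1 \*: (fun t => t `^ c).
    by apply/funext => t /=; rewrite mulrC.
  have dp := is_derive1_powR c x0.
  by apply: is_derive_eq; rewrite /GRing.scale/=; field; rewrite gt_eqF.
- rewrite -[X in _ --> X](mul0r c^-1); apply: cvgM; last exact: cvg_cst.
  exact: powR_cvg0.
Qed.

Lemma integral_expR_tail r u : 0 < r ->
  (\int[mu]_(t in `[u, +oo[) (expR (- (r * t)))%:E = (expR (- (r * u)) / r)%:E)%E.
Proof.
move=> r0.
have dF x : is_derive x 1 (fun t => - (expR (- (r * t)) / r)) (expR (- (r * x))).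
  have -> : (fun t => - (expR (- (r * t)) / r)) = (- r^-1) \*: (expR \o (fun t => - (r * t))).
    by apply/funext => t /=; rewrite /GRing.scale/= mulNr mulrC.
  by apply: is_derive_eq; rewrite /GRing.scale/=; field; rewrite gt_eqF.
have cexp : continuous (fun t => expR (- (r * t))).
  move=> x; apply: differentiable_continuous; apply/derivable1_diffP.
  exact: ex_derive.
rewrite (@ge0_continuous_FTC2y _ _ (fun t => - (expR (- (r * t)) / r)) _ 0).
- by rewrite -EFinB sub0r opprK.
- by move=> x _; exact: expR_ge0.
- exact: continuous_subspaceT.
- rewrite -oppr0; apply: cvgN; rewrite -(mul0r r^-1); apply: cvgMl.
  apply: (@cvg_comp _ _ _ (fun t => r * t) (fun t => expR (- t)) _ +oo); last first.
    exact: cvgr_expR.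
  exact: gt0_cvgMry.
- by move=> x _; apply: ex_derive; exact: dF.
- apply: cvg_at_right_filter; have : differentiable (fun t => - (expR (- (r * t)) / r)) u.
    by apply/derivable1_diffP; apply: ex_derive; exact: dF.
  exact: differentiable_continuous.
- by move=> x _; rewrite derive1E; apply: derive_val; exact: dF.
Qed.

Let mgamma (D : set R) x r :
  measurable_fun D (fun t : R => (t `^ x * expR (- (r * t)))%:E).
Proof.
apply/measurable_EFinP/measurable_funTS/measurable_funM; first exact: measurable_powR.
by apply: measurableT_comp => //; apply: measurableT_comp => //; exact: mulrl_measurable.
Qed.

Let mgamma1 (D : set R) x : measurable_fun D (fun t : R => (t `^ x * expR (- t))%:E).
Proof. by have := @mgamma D x 1; under eq_fun do rewrite mul1r. Qed.

(** With values in the extended reals the functional equation can be proved before finiteness is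
    known, and then serves to prove it. *)
Definition Gamma_integral x : \bar R := (\int[mu]_(t in Rp) (t `^ (x - 1) * expR (- t))%:E)%E.

Let Gamma_integral_ge0 x : (0 <= Gamma_integral x)%E.
Proof.
by apply: integral_ge0 => t _; rewrite lee_fin mulr_ge0 ?powR_ge0 ?expR_ge0.
Qed.

(** Writing t^x as the integral of x u^(x - 1) over []0, t]] and exchanging the integrals replaces
    integration by parts, so that no boundary term has to be controlled. *)
Let Gamma_integralS x : 0 < x -> (Gamma_integral (x + 1) = x%:E * Gamma_integral x)%E.
Proof.
move=> x0; rewrite /Gamma_integral addrK.
transitivity (\int[mu]_(t in Rp) \int[mu]_(u in Rp)
   (if u <= t then x * u `^ (x - 1) * expR (- t) else 0)%:E)%E.
  apply: eq_integral => t /set_mem /=; rewrite in_itv/= andbT => t0.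
  rewrite (@integral_if _ `]0, t]%classic); last first.
    by move=> u /=; rewrite !in_itv/= andbT; split => [/andP[]|[-> ->]].
  transitivity ((x * expR (- t))%:E * \int[mu]_(u in `]0%R, t]) (u `^ (x - 1))%:E)%E.
    by rewrite integral_powR_at0// -EFinM; congr EFin; field; rewrite gt_eqF.
  rewrite -ge0_integralZl//.
  - by apply: eq_integral => u _; rewrite -EFinM; congr EFin; ring.
  - by apply/measurable_EFinP/measurable_funTS; exact: measurable_powR.
  - by move=> u _; rewrite lee_fin powR_ge0.
  - by rewrite lee_fin mulr_ge0 ?expR_ge0// ltW.
rewrite tonelli_on//; last 2 first.
- apply/measurable_EFinP/measurable_funTS; apply: measurable_fun_ifT => //=.
  + exact: measurable_fun_ler.
  + apply: measurable_funM.
      by apply: measurable_funM => //; apply: (measurableT_comp (measurable_powR (x - 1))).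
    by apply: measurableT_comp => //; exact: measurableT_comp.
- move=> t u _ _; rewrite lee_fin; case: ifPn => // _.
  by rewrite mulr_ge0 ?expR_ge0// mulr_ge0 ?powR_ge0// ltW.
rewrite -ge0_integralZl//; last 3 first.
- exact: mgamma1.
- by move=> t _; rewrite lee_fin mulr_ge0 ?powR_ge0 ?expR_ge0.
- by rewrite lee_fin ltW.
apply: eq_integral => u /set_mem /=; rewrite in_itv/= andbT => u0.
rewrite (@integral_if _ `[u, +oo[%classic); last first.
  move=> t /=; rewrite !in_itv/= !andbT; split => [ut|[_]]//; split => //.
  exact: lt_le_trans ut.
have := @integral_expR_tail 1 u ltr01; under eq_integral do rewrite mul1r.
rewrite mul1r divr1 => H; rewrite -[RHS]EFinM mulrA [RHS]EFinM -H.
rewrite -ge0_integralZl//.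
- apply/measurable_EFinP/measurable_funTS.
  by apply: measurableT_comp => //; exact: measurableT_comp.
- by rewrite lee_fin mulr_ge0 ?powR_ge0// ltW.
Qed.

Let Gamma_integral1 : Gamma_integral 1 = 1%E.
Proof.
rewrite /Gamma_integral subrr; under eq_integral do rewrite powRr0 mul1r.
rewrite integral_itv_obnd_cbnd; last first.
  by apply/measurable_EFinP/measurable_funTS; exact: measurableT_comp.
have := @integral_expR_tail 1 0 ltr01; under eq_integral do rewrite mul1r.
by rewrite mulr0 oppr0 expR0 divr1.
Qed.

(** For t >= 1 the power t^(y - 1) is at most t^(z - 1), for t <= 1 it is at most t^(x - 1). *)
Let Gamma_integral_le x y z : x <= y -> y <= z ->
  (Gamma_integral y <= Gamma_integral x + Gamma_integral z)%E.
Proof.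
move=> xy yz; rewrite /Gamma_integral.
have G0 w t : (0 <= (t `^ w * expR (- t))%:E)%E.
  by rewrite lee_fin mulr_ge0 ?powR_ge0 ?expR_ge0.
rewrite -ge0_integralD//; [|exact: mgamma1|exact: mgamma1].
apply: ge0_le_integral => //.
- exact: mgamma1.
- by apply: emeasurable_funD; exact: mgamma1.
move=> t /=; rewrite in_itv/= andbT => t0.
rewrite -EFinD lee_fin -mulrDl ler_wpM2r ?expR_ge0//.
have [t1|/ltW t1] := leP 1 t.
  by rewrite -[leLHS]add0r lerD ?powR_ge0// ler_powR// lerB.
by rewrite -[leLHS]addr0 lerD ?powR_ge0// ger_powR ?t0// lerB.
Qed.

(** The integral is finite at 1 and at 2, hence between them; the functional equation carries this
    down to (0, 1] and then upwards by unit steps. *)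
Let Gamma_integral_lty x : 0 < x -> (Gamma_integral x < +oo)%E.
Proof.
have H12 y : 1 <= y -> y <= 2 -> (Gamma_integral y < +oo)%E.
  move=> y1 y2; apply: (le_lt_trans (Gamma_integral_le y1 y2)).
  rewrite -[2]/(1 + 1).
  by rewrite Gamma_integralS// mul1e Gamma_integral1 -EFinD ltry.
have H1 y : 0 < y -> y <= 1 -> (Gamma_integral y < +oo)%E.
  move=> y0 y1; have : (Gamma_integral (y + 1) < +oo)%E.
    by apply: H12; [rewrite lerDr ltW|rewrite -[2]/(1 + 1) lerD2r].
  rewrite Gamma_integralS// !ltey; apply: contra => /eqP ->.
  by rewrite gt0_muley.
have Hn (n : nat) : forall y, 0 < y -> y <= n%:R + 2 -> (Gamma_integral y < +oo)%E.
  elim: n => [|n IH] y y0 yn.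
    have [y1|/ltW y1] := leP y 1; first exact: H1.
    by apply: H12 => //; rewrite add0r in yn.
  have [y1|y1] := leP y 1; first exact: H1.
  rewrite -(subrK 1 y) Gamma_integralS ?subr_gt0//.
  have : (Gamma_integral (y - 1) < +oo)%E.
    by apply: IH; [rewrite subr_gt0|rewrite lerBlDr addrAC natr1].
  by rewrite -!ge0_fin_numE ?mule_ge0 ?lee_fin ?subr_ge0 ?(ltW y1)// => h; exact: fin_numM.
move=> x0; apply: (Hn (Num.truncn x)) => //.
by rewrite (le_trans (ltW (truncnS_gt x)))// -natr1 lerD2l ler1n.
Qed.

Lemma Gamma_integralE x : 0 < x -> Gamma_integral x = (Gamma_pos x)%:E.
Proof.
move=> x0; rewrite /Gamma_pos /Rintegral fineK//.
by rewrite ge0_fin_numE ?Gamma_integral_lty// Gamma_integral_ge0.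
Qed.

Lemma Gamma_posS x : 0 < x -> Gamma_pos (x + 1) = x * Gamma_pos x.
Proof.
move=> x0; have := Gamma_integralS x0.
by rewrite !Gamma_integralE ?addr_gt0// -EFinM => -[].
Qed.

(** On []0, 1]] the factor exp(-t) is at least exp(-1), which leaves the elementary integral 1 /
    x. *)
Lemma Gamma_pos_gt0 x : 0 < x -> 0 < Gamma_pos x.
Proof.
move=> x0; rewrite -lte_fin -Gamma_integralE//.
have H1 : (\int[mu]_(t in `]0%R, 1%R]) (t `^ (x - 1) * expR (- t))%:E <= Gamma_integral x)%E.
  apply: ge0_subset_integral => //; first exact: mgamma1.
    by move=> t _; rewrite lee_fin mulr_ge0 ?powR_ge0 ?expR_ge0.
  by move=> t /=; rewrite !in_itv/= andbT => /andP[].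
apply: lt_le_trans H1.
have H2 : (0 < \int[mu]_(t in `]0%R, 1%R]) ((expR (-1))%:E * (t `^ (x - 1))%:E))%E.
  rewrite ge0_integralZl//.
  - by rewrite integral_powR_at0// -EFinM lte_fin mulr_gt0 ?expR_gt0// powR1 divr_gt0.
  - by apply/measurable_EFinP/measurable_funTS; exact: measurable_powR.
  - by move=> t _; rewrite lee_fin powR_ge0.
apply: (lt_le_trans H2); apply: ge0_le_integral => //.
- by move=> t _; rewrite -EFinM lee_fin mulr_ge0 ?powR_ge0 ?expR_ge0.
- apply: measurable_funeM; apply/measurable_EFinP/measurable_funTS.
  exact: measurable_powR.
- exact: mgamma1.
move=> t /=; rewrite in_itv/= => /andP[t0 t1].
by rewrite -EFinM lee_fin mulrC ler_wpM2l ?powR_ge0// ler_expR lerN2.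
Qed.

Lemma integral_gamma_rate x r : 0 < x -> 0 < r ->
  (\int[mu]_(t in Rp) (t `^ (x - 1) * expR (- (r * t)))%:E = (Gamma_pos x * r `^ (- x))%:E)%E.
Proof.
move=> x0 r0; rewrite EFinM -Gamma_integralE// /Gamma_integral.
rewrite [X in _ = (X * _)%E](ge0_integral_scale r0); last 2 first.
- exact: mgamma1.
- by move=> t _; rewrite lee_fin mulr_ge0 ?powR_ge0 ?expR_ge0.
rewrite muleAC -EFinM -ge0_integralZl//.
- apply: eq_integral => t /set_mem /=; rewrite in_itv/= andbT => t0.
  rewrite -EFinM; congr EFin; rewrite powRM ?ltW// [X in _ = X]mulrA; congr (_ * _).
  rewrite mulrA -[X in X * r `^ (- x)](powRr1 (ltW r0)) -!gt0_powRD//.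
  by rewrite [_ + (x - 1)](_ : _ = 0) ?powRr0 ?mul1r//; ring.
- apply/measurable_EFinP/measurable_funTS/measurable_funM.
    by apply: (measurableT_comp (measurable_powR (x - 1))); exact: mulrl_measurable.
  by apply: measurableT_comp => //; apply: measurableT_comp => //; exact: mulrl_measurable.
- by move=> t _; rewrite lee_fin mulr_ge0 ?powR_ge0 ?expR_ge0.
- by rewrite lee_fin mulr_ge0 ?powR_ge0// ltW.
Qed.

(** Gamma(a + c) (s + z t)^(-(a + c)) is itself a Gamma integral, with rate s + z t. After the
    exchange both remaining integrals are of Gamma type. *)
Lemma beta_integral a c s t : 0 < a -> 0 < c -> 0 < s -> 0 < t ->
  (\int[mu]_(z in Rp) (z `^ (c - 1) * (s + z * t) `^ (- (a + c)))%:E =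
   (Gamma_pos a * Gamma_pos c / Gamma_pos (a + c) * s `^ (- a) * t `^ (- c))%:E)%E.
Proof.
move=> a0 c0 s0 t0; have ac0 : 0 < a + c by rewrite addr_gt0.
have G0 := Gamma_pos_gt0 ac0.
have mbeta : measurable_fun Rp (fun z => (z `^ (c - 1) * (s + z * t) `^ (- (a + c)))%:E).
  apply/measurable_EFinP/measurable_funTS/measurable_funM; first exact: measurable_powR.
  apply: (measurableT_comp (measurable_powR (- (a + c)))).
  by apply: measurable_funD => //; exact: mulrr_measurable.
have : ((Gamma_pos (a + c))%:E * \int[mu]_(z in Rp) (z `^ (c - 1) * (s + z * t) `^ (- (a + c)))%:E
  = (Gamma_pos a * Gamma_pos c * s `^ (- a) * t `^ (- c))%:E)%E; last first.
  move=> H; have := congr1 (fun x : \bar R => (Gamma_pos (a + c))^-1%:E * x)%E H.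
  rewrite muleA -!EFinM mulVf ?gt_eqF// mul1e => ->; congr EFin.
  by rewrite mulrC -!mulrA; congr (_ * (_ * _)); rewrite mulrA mulrC.
rewrite -ge0_integralZl//; last 2 first.
- by move=> z _; rewrite lee_fin mulr_ge0 ?powR_ge0.
- by rewrite lee_fin ltW.
transitivity (\int[mu]_(z in Rp) \int[mu]_(x in Rp)
   (z `^ (c - 1) * (x `^ (a + c - 1) * expR (- ((s + z * t) * x))))%:E)%E.
  apply: eq_integral => z /set_mem /=; rewrite in_itv/= andbT => z0.
  have r0 : 0 < s + z * t by rewrite addr_gt0// mulr_gt0.
  rewrite -EFinM mulrCA EFinM -integral_gamma_rate// -ge0_integralZl//.
  - exact: mgamma.
  - by move=> x _; rewrite lee_fin mulr_ge0 ?powR_ge0 ?expR_ge0.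
  - by rewrite lee_fin powR_ge0.
rewrite tonelli_on//; last 2 first.
- apply/measurable_EFinP/measurable_funTS; apply: measurable_funM.
    exact: (measurableT_comp (measurable_powR (c - 1))).
  apply: measurable_funM; first exact: (measurableT_comp (measurable_powR (a + c - 1))).
  apply: measurableT_comp => //; apply: measurableT_comp => //.
  apply: measurable_funM => //; apply: measurable_funD => //.
  exact: measurable_funM.
- by move=> z x _ _; rewrite lee_fin !mulr_ge0 ?powR_ge0 ?expR_ge0.
transitivity (\int[mu]_(x in Rp) ((Gamma_pos c * t `^ (- c))%:E *
   (x `^ (a - 1) * expR (- (s * x)))%:E))%E.
  apply: eq_integral => x /set_mem /=; rewrite in_itv/= andbT => x0.
  transitivity (\int[mu]_(z in Rp) ((x `^ (a + c - 1) * expR (- (s * x)))%:E *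
     (z `^ (c - 1) * expR (- ((x * t) * z)))%:E))%E.
    apply: eq_integral => z _; rewrite -EFinM; congr EFin.
    by rewrite mulrDl opprD expRD; rewrite [z * t * x](_ : _ = x * t * z); ring.
  rewrite ge0_integralZl//.
  - rewrite integral_gamma_rate// ?mulr_gt0// -!EFinM; congr EFin.
    rewrite powRM ?ltW// [x `^ (a + c - 1)](_ : _ = x `^ (a - 1) * x `^ c); last first.
      by rewrite -gt0_powRD//; congr (_ `^ _); ring.
    have := powR_gt0 c x0; rewrite [x `^ (- c)]powRN.
    move: (x `^ c) (x `^ (a - 1)) (expR _) (Gamma_pos c) (t `^ (- c)) => X Y Z G W X0.
    by field; rewrite gt_eqF.
  - exact: mgamma.
  - by move=> z _; rewrite lee_fin mulr_ge0 ?powR_ge0 ?expR_ge0.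
  - by rewrite lee_fin mulr_ge0 ?powR_ge0 ?expR_ge0.
rewrite ge0_integralZl//.
- rewrite integral_gamma_rate// -EFinM; congr EFin.
  by rewrite mulrC -!mulrA; congr (_ * _); rewrite mulrCA.
- exact: mgamma.
- by move=> x _; rewrite lee_fin mulr_ge0 ?powR_ge0 ?expR_ge0.
- by rewrite lee_fin; apply: mulr_ge0; [exact/ltW/Gamma_pos_gt0|exact: powR_ge0].
Qed.

(** On (x / 2, x + 1) the integrand is dominated by the sum of the integrands at the two endpoints,
    one taking care of t <= 1 and the other of t >= 1. *)
Lemma continuous_Gamma_pos x : 0 < x -> {for x, continuous (@Gamma_pos R)}.
Proof.
move=> x0.
have H := @continuity_under_integral R _ _ mu
  (fun y (t : R) => t `^ (y - 1) * expR (- t)) Rp _ (x / 2) (x + 1)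
  _ _ (fun t => t `^ (x / 2 - 1) * expR (- t) + t `^ (x + 1 - 1) * expR (- t)).
have iG y : 0 < y -> mu.-integrable Rp (fun t => (t `^ (y - 1) * expR (- t))%:E).
  move=> y0; apply/integrableP; split; first exact: mgamma1.
  under eq_integral do rewrite gee0_abs ?lee_fin ?mulr_ge0 ?powR_ge0 ?expR_ge0//.
  exact: Gamma_integral_lty.
apply: H => //.
- move=> y; rewrite /= in_itv/= => /andP[xy _]; apply: iG.
  by rewrite (lt_trans _ xy)// divr_gt0.
- apply: aeW => t /=; rewrite in_itv/= andbT => t0 y _.
  apply: cvgMl; rewrite /powR gt_eqF//.
  apply: continuous_comp; last exact: continuous_expR.
  by apply: cvgMl; apply: cvgB => //; exact: cvg_cst.
- rewrite (_ : EFin \o _ = (fun t => (t `^ (x / 2 - 1) * expR (- t))%:E) \+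
    (fun t => (t `^ (x + 1 - 1) * expR (- t))%:E))%E//.
  by apply: integrableD => //; apply: iG; rewrite ?divr_gt0// addr_gt0.
- move=> y; rewrite /= in_itv/= => /andP[xy yx]; apply: aeW => t /=.
  rewrite in_itv/= andbT => t0.
  rewrite ger0_norm ?mulr_ge0 ?powR_ge0 ?expR_ge0// -mulrDl ler_wpM2r ?expR_ge0//.
  have [t1|/ltW t1] := leP 1 t.
    by rewrite -[leLHS]add0r lerD ?powR_ge0// ler_powR// lerB// ltW.
  by rewrite -[leLHS]addr0 lerD ?powR_ge0// ger_powR ?t0// lerB// ltW.
- by apply/mem_set; rewrite /= in_itv/=; apply/andP; split; lra.
Qed.

Lemma GammaE x : 0 < x -> Gamma x = Gamma_pos x.
Proof. by rewrite /Gamma => ->. Qed.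

(** The arguments that occur, alpha1 - 1 and alpha1 - 1 - nu, exceed -1, so a single shift makes
    them positive. At the pole 0 the convention that Gamma is 0 there makes both sides vanish. *)
Lemma Gamma_inv x : - 1 < x -> (Gamma x)^-1 = x / Gamma_pos (x + 1).
Proof.
move=> x1; rewrite /Gamma; case: ifPn => [x0|].
  by rewrite Gamma_posS// invfM mulrA mulfV ?mul1r// gt_eqF.
rewrite -leNgt => x0.
have -> : Num.truncn (- x) = 0%N.
  by apply/eqP; rewrite -leqn0 -ltnS truncn_lt_nat ?oppr_ge0// ltrNl.
by rewrite big_ord1 addr0 invf_div.
Qed.

End GammaFunction.

(** * The hypergeometric function *)

Section PowerSeries.
Context {R : realType}.
Implicit Types (u : R^nat) (x : R).

(** A ratio test for radius of convergence at least 1, written without quotients because the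
    coefficients (b)_n / (c)_n vanish from some n on when b is a nonpositive integer. *)
Definition subgeometric u := forall e : R, 0 < e ->
  exists N, forall n, (N <= n)%N -> `|u n.+1| <= (1 + e) * `|u n|.

Lemma subgeometric_diffs u : subgeometric u -> subgeometric (pseries_diffs u).
Proof.
move=> su e e0.
have e30 : 0 < e / 3 by rewrite divr_gt0.
have [N HN] := su _ e30.
(* Differentiation multiplies the ratio of consecutive coefficients by (n + 2) / (n + 1), which the
   slack between 1 + e / 3 and 1 + e absorbs once n >= 3 / e. *)
exists (maxn N (Num.truncn (3 / e)).+1) => n; rewrite geq_max => /andP[Nn en].
have n0 : 0 < n%:R :> R by rewrite ltr0n (leq_ltn_trans _ en).
have : 3 / e <= n%:R.
  by apply: (le_trans (ltW (truncnS_gt _))); rewrite ler_nat.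
rewrite ler_pdivrMr// => ne.
have := HN n.+1 (leqW Nn); rewrite /pseries_diffs !normrM !normr_nat.
move=> H; rewrite mulrCA.
apply: (le_trans (ler_wpM2l _ H)) => //; rewrite !mulrA ler_wpM2r//.
rewrite -[n.+2%:R]natr1 -[n.+1%:R]natr1.
move: (n%:R) ne => k ne; lra.
Qed.

Lemma cvg_subgeometric u x : subgeometric u -> `|x| < 1 -> cvgn (pseries u x).
Proof.
(* The ratio [q] lies between |x| and 1, and (1 + e) |x| <= q amounts to 0 <= (1 - |x|)^2. *)
move=> su x1; pose q := (1 + `|x|) / 2; pose e := (1 - `|x|) / 2.
have x0 := normr_ge0 x.
have q0 : 0 < q by rewrite /q; lra.
have q1 : q < 1 by rewrite /q; lra.
have e0 : 0 < e by rewrite /e; lra.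
have qe : (1 + e) * `|x| <= q by rewrite /e /q; nra.
have [N HN] := su _ e0.
pose w n := u n * x ^+ n.
have [C C0 HC] : exists2 C : R, 0 <= C & forall n, (n <= N)%N -> `|w n| <= C * q ^+ n.
  elim: N {HN} => [|N [C C0 IH]].
    exists `|w 0%N| => // n; rewrite leqn0 => /eqP ->; by rewrite expr0 mulr1.
  exists (C + `|w N.+1| / q ^+ N.+1) => [|n].
    by rewrite addr_ge0// divr_ge0// exprn_ge0// ltW.
  rewrite leq_eqVlt ltnS => /orP[/eqP ->|/IH H].
    by rewrite mulrDl divfK ?expf_neq0 ?gt_eqF// lerDr mulr_ge0// exprn_ge0// ltW.
  apply: (le_trans H); rewrite ler_wpM2r ?exprn_ge0 ?(ltW q0)//.
  by rewrite lerDl divr_ge0// exprn_ge0// ltW.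
have {}HC n : `|w n| <= C * q ^+ n.
  have [|] := leqP n N; first exact: HC.
  elim: n => // n IH; rewrite ltnS => Nn.
  have {}IH : `|w n| <= C * q ^+ n.
    by move: Nn; rewrite leq_eqVlt => /orP[/eqP <-|/IH//]; exact: HC.
  rewrite /w !exprS normrM normrM.
  apply: (le_trans (ler_wpM2r _ (HN _ Nn))); first by rewrite mulr_ge0.
  rewrite (_ : _ * _ = ((1 + e) * `|x|) * `|w n|); last by rewrite /w normrM; ring.
  rewrite mulrCA; apply: ler_pM => //.
  by rewrite mulr_ge0// addr_ge0// ltW.
apply: normed_cvg; apply: (@series_le_cvg _ _ (geometric C q)) => //.
- by move=> n /=; exact: normr_ge0.
- by move=> n /=; rewrite mulr_ge0// exprn_ge0// ltW.
- by apply: is_cvg_geometric_series; rewrite ger0_norm// ltW.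
Qed.

(** Differentiating term by term uses the convergence of the series and of its first two derived
    series at a point [K] between |x| and 1, which is why stability under [pseries_diffs] was
    established. *)
Lemma is_derive_pseries u x : subgeometric u -> `|x| < 1 ->
  is_derive x 1 (fun x => limn (pseries u x)) (limn (pseries (pseries_diffs u) x)).
Proof.
move=> su x1; pose K := (1 + `|x|) / 2; have x0 := normr_ge0 x.
have K0 : 0 < K by rewrite /K; lra.
have K1 : `|K| < 1 by rewrite gtr0_norm// /K; lra.
apply: (@pseries_snd_diffs _ _ K); do ?[exact: cvg_subgeometric|].
- by apply: cvg_subgeometric => //; exact: subgeometric_diffs.
- by apply: cvg_subgeometric => //; do 2 apply: subgeometric_diffs.
- by rewrite [ltRHS]gtr0_norm// /K; lra.
Qed.

End PowerSeries.

(** * 2F1 with numerator parameter 1 and its integral representation *)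

Section Hypergeometric.
Context {R : realType}.
Local Notation mu := (@lebesgue_measure R).
Local Notation Rp := (`]0%R, +oo[%classic : set R).
Implicit Types a b c m s t u v x y z : R.

Lemma risingS s n : rising s n.+1 = rising s n * (s + n%:R).
Proof. by rewrite /rising big_ord_recr. Qed.

Lemma rising0 s : rising s 0 = 1.
Proof. by rewrite /rising big_ord0. Qed.

Lemma rising1 n : rising 1 n = n`!%:R :> R.
Proof.
elim: n => [|n IH]; first by rewrite rising0.
by rewrite risingS IH factS mulnC natrM -[n.+1%:R]natr1 [1 + _]addrC.
Qed.

Lemma rising_gt0 c n : 0 < c -> 0 < rising c n.
Proof. by move=> c0; apply: prodr_gt0 => i _; rewrite ltr_wpDr. Qed.

(** The coefficients of 2F1(1, b; c; x), where the factor (1)_n of the numerator cancels n!. *)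
Definition hyp_coef b c n : R := rising b n / rising c n.

Lemma gauss_series1 b c x : gauss_series 1 b c x = limn (pseries (hyp_coef b c) x).
Proof.
rewrite /gauss_series /pseries; congr (limn (series _)); apply/funext => n /=.
rewrite rising1 /hyp_coef [rising c n * _]mulrC -mulf_div divff ?mul1r//.
Qed.

Lemma hyp_coefS b c n : 0 < c ->
  (c + n%:R) * hyp_coef b c n.+1 = (b + n%:R) * hyp_coef b c n.
Proof.
move=> c0; rewrite /hyp_coef !risingS.
have := rising_gt0 n c0; have : 0 < c + n%:R by rewrite ltr_wpDr.
move: (rising c n) (rising b n) (c + n%:R) (b + n%:R) => X Y Z W Z0 X0.
by field; rewrite !gt_eqF.
Qed.

Lemma subgeometric_hyp_coef b c : 0 < c -> subgeometric (hyp_coef b c).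
Proof.
move=> c0 e e0; exists (Num.truncn ((`|b| + c) / e)).+1 => n en.
have : (`|b| + c) / e <= n%:R.
  by apply: (le_trans (ltW (truncnS_gt _))); rewrite ler_nat.
rewrite ler_pdivrMr// => ne.
have cn : 0 < c + n%:R by rewrite ltr_wpDr.
rewrite -(ler_pM2l cn) -{1}(gtr0_norm cn) -normrM hyp_coefS// normrM mulrA.
rewrite ler_wpM2r//; apply: (le_trans (ler_normD _ _)); rewrite normr_nat.
have := mulr_gt0 c0 e0; move: (n%:R) ne {cn en} => k ne ce; lra.
Qed.

(* The numerator parameter 1 makes 2F1(1, b; c; x) satisfy a first order equation. *)
Lemma hyp_ode b c x : 0 < c -> `|x| < 1 ->
  (1 - x) * x * limn (pseries (pseries_diffs (hyp_coef b c)) x) +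
  (c - 1 - b * x) * limn (pseries (hyp_coef b c) x) = c - 1.
Proof.
move=> c0 x1; set A := hyp_coef b c.
have sA : subgeometric A by exact: subgeometric_hyp_coef.
have [F [cS ->]] : exists F : R, (pseries A x @ \oo --> F) /\ limn (pseries A x) = F.
  by exists (limn (pseries A x)); split => //; exact: cvg_subgeometric.
have [G [cG ->]] : exists G : R, (pseries (pseries_diffs A) x @ \oo --> G) /\
    limn (pseries (pseries_diffs A) x) = G.
  exists (limn (pseries (pseries_diffs A) x)); split => //.
  by apply: cvg_subgeometric => //; exact: subgeometric_diffs.
(* The equation for partial sums, with the truncation orders that make it exact. The left side is
   the sum over k = 1, ..., n + 1 of (c + k - 1) A_k x^k, the right side that of (b + k - 1) A_(k-1)
   x^k, and these terms agree by [hyp_coefS]. *)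
have rec n : x * pseries (pseries_diffs A) x n.+1 + (c - 1) * (pseries A x n.+2 - 1)
    = b * x * pseries A x n.+1 + x * x * pseries (pseries_diffs A) x n.
  elim: n => [|n IH].
    rewrite /pseries /series /= !big_nat1 2?big_nat_recr//= !big_geq// expr1.
    have := hyp_coefS b 0 c0; rewrite -/A /pseries_diffs.
    have -> : A 0%N = 1 by rewrite /A /hyp_coef !rising0 divff.
    rewrite !addr0 !expr0 => H.
    have : x * (c * A 1%N) = x * (b * 1) by rewrite H.
    lra.
  have S1 : pseries A x n.+3 = pseries A x n.+2 + A n.+2 * x ^+ n.+2.
    by rewrite /pseries seriesSr.
  have S2 : pseries A x n.+2 = pseries A x n.+1 + A n.+1 * x ^+ n.+1.
    by rewrite /pseries seriesSr.
  have G1 : pseries (pseries_diffs A) x n.+2 = pseries (pseries_diffs A) x n.+1 +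
     n.+2%:R * A n.+2 * x ^+ n.+1 by rewrite /pseries seriesSr.
  have G2 : pseries (pseries_diffs A) x n.+1 = pseries (pseries_diffs A) x n +
     n.+1%:R * A n.+1 * x ^+ n by rewrite /pseries seriesSr.
  have := hyp_coefS b n.+1 c0; rewrite -/A.
  rewrite S1 G1 {2}S2 {2}G2 -[n.+2%:R]natr1.
  move: IH; rewrite !exprS.
  move: (pseries A x n.+2) (pseries A x n.+1) (pseries (pseries_diffs A) x n.+1)
    (pseries (pseries_diffs A) x n) (A n.+2) (A n.+1) (x ^+ n) (n.+1%:R) => S2' S1' G1' G0' A2 A1 p k.
  move=> IH H.
  have : x * x * p * ((c + k) * A2) = x * x * p * ((b + k) * A1) by rewrite H.
  lra.
have L1 : x * pseries (pseries_diffs A) x n.+1 + (c - 1) * (pseries A x n.+2 - 1)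
    @[n --> \oo] --> x * G + (c - 1) * (F - 1).
  apply: cvgD; apply: cvgM; do ?exact: cvg_cst.
    by move: cG; rewrite -(cvg_shiftn 1); under eq_fun do rewrite addn1.
  apply: cvgB; last exact: cvg_cst.
  by move: cS; rewrite -(cvg_shiftn 2); under eq_fun do rewrite addn2.
have L2 : b * x * pseries A x n.+1 + x * x * pseries (pseries_diffs A) x n
    @[n --> \oo] --> b * x * F + x * x * G.
  apply: cvgD; apply: cvgM; do ?exact: cvg_cst; last by [].
  by move: cS; rewrite -(cvg_shiftn 1); under eq_fun do rewrite addn1.
have E := funext rec; rewrite E in L1.
have : x * G + (c - 1) * (F - 1) = b * x * F + x * x * G by exact: (cvg_unique (@norm_hausdorff _ _) L1 L2).
lra.
Qed.

Lemma hyp_at0 b c : limn (pseries (hyp_coef b c) 0) = 1.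
Proof.
apply/cvg_lim => //; rewrite -(cvg_shiftS _).
rewrite (_ : (fun _ => _) = cst 1); first exact: cvg_cst.
apply/funext => n; rewrite /pseries /series /= big_nat_recl//= expr0 mulr1.
rewrite {1}/hyp_coef !rising0 divff// big1 ?addr0// => i _.
by rewrite exprS mul0r mulr0.
Qed.

(** The incomplete beta integral of t^(c - 1) (1 + t)^(-m) over []0, z]], divided by z^c through t =
    z s. On the fixed domain []0, 1]], continuity in the parameters and monotonicity in z can be
    read off the integrand. *)
Definition beta_kernel c m z : R := \int[mu]_(s in `]0, 1]) (s `^ (c - 1) * (1 + z * s) `^ (- m)).

Let mkernel c m z (D : set R) :
  measurable_fun D (fun s : R => s `^ (c - 1) * (1 + z * s) `^ (- m)).
Proof.
apply/measurable_funTS/measurable_funM; first exact: measurable_powR.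
apply: (measurableT_comp (measurable_powR (- m))).
by apply: measurable_funD => //; exact: mulrl_measurable.
Qed.

Let kernel_le c m z s k (B : R) : 0 <= z <= k -> `|m| <= B -> 0 <= s <= 1 ->
  s `^ (c - 1) * (1 + z * s) `^ (- m) <= (1 + k) `^ B * s `^ (c - 1).
Proof.
move=> /andP[z0 zk] mB /andP[s0 s1]; rewrite mulrC ler_wpM2r ?powR_ge0//.
have zs0 : 0 <= z * s by rewrite mulr_ge0.
have h1 : 1 <= 1 + z * s by rewrite lerDl.
have B0 : 0 <= B by rewrite (le_trans _ mB).
apply: (@le_trans _ _ ((1 + z * s) `^ B)).
  by apply: ler_powR => //; rewrite (le_trans _ mB)// -normrN ler_norm.
apply: ge0_ler_powR => //; rewrite ?nnegrE; [lra|nra|].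
by rewrite lerD2l; nra.
Qed.

Let integrable_dom c C : 0 < c -> mu.-integrable `]0%R, 1%R] (fun s => (C * s `^ (c - 1))%:E).
Proof.
move=> c0; rewrite (_ : (fun s => _) = (fun s => C%:E * (s `^ (c - 1))%:E)%E)//.
apply: integrableZl => //; apply/integrableP; split.
  by apply/measurable_EFinP/measurable_funTS; exact: measurable_powR.
under eq_integral do rewrite gee0_abs ?lee_fin ?powR_ge0//.
by rewrite integral_powR_at0// ltry.
Qed.

Lemma integrable_kernel c m z : 0 < c -> 0 <= z ->
  mu.-integrable `]0%R, 1%R] (fun s => (s `^ (c - 1) * (1 + z * s) `^ (- m))%:E).
Proof.
move=> c0 z0; apply: le_integrable (integrable_dom ((1 + z) `^ `|m|) c0) => //.
  by apply/measurable_EFinP; exact: mkernel.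
move=> s /=; rewrite in_itv/= => /andP[s0 s1]; rewrite lee_fin.
rewrite [leLHS]ger0_norm ?mulr_ge0 ?powR_ge0// [leRHS]ger0_norm ?mulr_ge0 ?powR_ge0//.
by apply: kernel_le; rewrite ?z0 ?lexx ?(ltW s0).
Qed.

Lemma beta_kernelE c m z : 0 < c -> 0 <= z -> (beta_kernel c m z)%:E =
  (\int[mu]_(s in `]0%R, 1%R]) (s `^ (c - 1) * (1 + z * s) `^ (- m))%:E)%E.
Proof.
move=> c0 z0; rewrite /beta_kernel /Rintegral fineK//.
apply: integrable_fin_num => //; exact: integrable_kernel.
Qed.

Lemma incomplete_betaE c m z : 0 < c -> 0 < z ->
  (\int[mu]_(t in `]0%R, z]) (t `^ (c - 1) * (1 + t) `^ (- m))%:E)%E =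
  (z `^ c * beta_kernel c m z)%:E.
Proof.
move=> c0 z0.
rewrite EFinM beta_kernelE ?(ltW z0)//.
rewrite -(@integral_if R Rp _ (fun t => t <= z)); last first.
  by move=> t /=; rewrite !in_itv/= andbT; split=> [/andP[]|[-> ->]].
rewrite (ge0_integral_scale z0); last 2 first.
- apply/measurable_EFinP/measurable_funTS/measurable_fun_ifT => //=.
    exact: measurable_fun_ler.
  by have := @mkernel c m 1 setT; under eq_fun do rewrite mul1r.
- by move=> t _; rewrite lee_fin; case: ifPn => // _; rewrite mulr_ge0 ?powR_ge0.
rewrite -(@integral_if R Rp `]0%R, 1%R]%classic (fun s => s <= 1)); last first.
  by move=> t /=; rewrite !in_itv/= andbT; split=> [/andP[]|[-> ->]].
have mif (b : R -> bool) (f : R -> R) : measurable_fun [set: R] b ->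
    measurable_fun [set: R] f -> measurable_fun Rp (fun s => if b s then f s else 0).
  by move=> mb mf; apply/measurable_funTS/measurable_fun_ifT.
rewrite -ge0_RintegralZl; last 4 first.
- exact: measurable_itv.
- apply: mif; first by apply: measurable_fun_ler; [exact: mulrl_measurable|exact: measurable_cst].
  apply: measurable_funM.
    by apply: (measurableT_comp (measurable_powR (c - 1))); exact: mulrl_measurable.
  apply: (measurableT_comp (measurable_powR (- m))).
  by apply: measurable_funD; [exact: measurable_cst|exact: mulrl_measurable].
- by move=> s _; case: ifPn => // _; rewrite mulr_ge0 ?powR_ge0.
- exact: ltW.
rewrite -ge0_RintegralZl; last 4 first.
- exact: measurable_itv.
- apply: mif; first by apply: measurable_fun_ler; [exact: measurable_id|exact: measurable_cst].
  exact: mkernel.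
- by move=> s _; case: ifPn => // _; rewrite mulr_ge0 ?powR_ge0.
- exact: powR_ge0.
apply: eq_integral => s /set_mem /=; rewrite in_itv/= andbT => s0.
congr EFin; rewrite ger_pMr//; case: ifPn => _; last by rewrite !mulr0.
rewrite powRM ?ltW// !mulrA; congr (_ * _ * _).
by rewrite mulr_powRB1// ltW.
Qed.

(** As functions of the shape x = alpha1, the exponent m = x + (alpha2 - 1) and the argument Z, a
    multiple of 1 / x, vary together. Continuity along this curve is what fills in the removable
    singularities. *)
Lemma continuous_beta_kernel c k e a : 0 < c -> 0 < k -> 0 < a ->
  {for a, continuous (fun x => beta_kernel c (x + e) (k / x))}.
Proof.
move=> c0 k0 a0.
(* For x between a / 2 and 2 a the argument k / x is at most 2 k / a and |x + e| is at most 2 a +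
   |e|, whence the dominating function. *)
have H := @continuity_under_integral R _ _ mu
  (fun x (s : R) => s `^ (c - 1) * (1 + k / x * s) `^ (- (x + e))) `]0%R, 1%R]%classic _
  (a / 2) (a * 2) _ _ (fun s => (1 + 2 * k / a) `^ (a * 2 + `|e|) * s `^ (c - 1)).
have I0 x : (`]a / 2, a * 2[%classic : set R) x -> 0 < x /\ (0 < k / x <= 2 * k / a /\ `|x + e| <= a * 2 + `|e|).
  rewrite /= in_itv/= => /andP[ax xa]; have x0 : 0 < x by lra.
  split => //; split.
    rewrite divr_gt0//= ler_pdivrMr// mulrAC ler_pdivlMr//; nra.
  by apply: (le_trans (ler_normD _ _)); rewrite lerD2r gtr0_norm// ltW.
apply: H => //.
- by move=> x /I0[x0 _]; apply: integrable_kernel => //; rewrite divr_ge0// ltW.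
- apply: aeW => s /=; rewrite in_itv/= => /andP[s0 s1] x /set_mem /I0[x0 _].
  have h0 y : 0 < y -> 0 < 1 + k / y * s by move=> y0; rewrite addr_gt0// mulr_gt0// divr_gt0.
  apply: cvgMr.
  have : expR (- (y + e) * ln (1 + k / y * s)) @[y --> x] --> expR (- (x + e) * ln (1 + k / x * s)).
    apply: continuous_cvg; first exact: continuous_expR.
    apply: cvgM; first by apply: cvgN; apply: cvgD => //; exact: cvg_cst.
    apply: continuous_cvg; first exact/continuous_ln/h0.
    apply: cvgD; first exact: cvg_cst.
    apply: cvgMl; apply: cvgMr; apply: cvgV => //; by rewrite gt_eqF.
  rewrite {2}/powR gt_eqF ?h0//; apply: cvg_trans; apply: near_eq_cvg; near=> y.
  by rewrite /powR gt_eqF// h0//; near: y; exact: lt_nbhsr.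
- exact: integrable_dom.
- move=> x /I0[x0 [/andP[kx0 kx] xe]]; apply: aeW => s /=; rewrite in_itv/= => /andP[s0 s1].
  rewrite ger0_norm ?mulr_ge0 ?powR_ge0//; apply: kernel_le => //.
    by rewrite kx (ltW kx0).
  by rewrite (ltW s0).
- by apply/mem_set; rewrite /= in_itv/=; apply/andP; split; lra.
Unshelve. all: by end_near. Qed.

Let is_derive_1D z : is_derive z 1 (fun t : R => 1 + t) 1.
Proof.
rewrite (_ : (fun t => _) = cst 1 + id)//.
by apply: is_derive_eq; rewrite add0r.
Qed.

(* Multiplied by [z `^ (c - 1) * (1 + z) `^ (1 - m)], a solution of the equation
   becomes a primitive of [(m - 1) * z `^ (c - 1) * (1 + z) `^ (- m)]. *)
Lemma incomplete_beta_ode c m Z (v dv : R -> R) : 0 < c -> 0 < Z ->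
  (forall z, 0 <= z <= Z -> is_derive z 1 v (dv z)) -> v 0 = 0 ->
  (forall z, 0 < z <= Z ->
     z * (1 + z) * dv z + ((c - 1) * (1 + z) + (1 - m) * z) * v z = (m - 1) * z) ->
  v Z = (m - 1) * (Z * (1 + Z) `^ (m - 1) * beta_kernel c m Z).
Proof.
move=> c0 Z0 dvE v0 ode.
pose Phi z := z `^ (c - 1) * (1 + z) `^ (1 - m) * v z.
pose phi z := z `^ (c - 1) * (1 + z) `^ (- m).
have dPhi z : 0 < z -> z <= Z -> is_derive z 1 Phi ((m - 1) * phi z).
  move=> z0 zZ; have z10 : 0 < 1 + z by rewrite addr_gt0.
  have d1 := is_derive1_powR (c - 1) z0.
  have d2' := is_derive1_powR (1 - m) z10.
  have d2 : is_derive z 1 (fun z : R => (1 + z) `^ (1 - m)) ((1 - m) * (1 + z) `^ (1 - m - 1)).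
    have dp := is_derive_1D z.
    by have := is_derive1_comp d2' dp; rewrite mulr1.
  have d3 : is_derive z 1 v (dv z) by apply: dvE; rewrite (ltW z0).
  rewrite /Phi (_ : (fun z => _) = ((fun z => z `^ (c - 1)) * (fun z => (1 + z) `^ (1 - m))) * v)//.
  apply: is_derive_eq; rewrite /GRing.scale/= !fctE /= /phi.
  have P0 := powR_gt0 (c - 1 - 1) z0; have Q0 := powR_gt0 (- m) z10.
  rewrite (_ : 1 - m - 1 = - m); last by ring.
  have -> : (1 + z) `^ (1 - m) = (1 + z) * (1 + z) `^ (- m).
    by rewrite gt0_powRD// powRr1// ltW.
  have -> : z `^ (c - 1) = z * z `^ (c - 1 - 1).
    by rewrite -[X in X * _](powRr1 (ltW z0)) -gt0_powRD//; congr (_ `^ _); ring.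
  have /ode : 0 < z <= Z by rewrite z0.
  move: (z `^ (c - 1 - 1)) ((1 + z) `^ (- m)) (v z) (dv z) => P Q V D H.
  transitivity (P * Q * (z * (1 + z) * D + ((c - 1) * (1 + z) + (1 - m) * z) * V)).
    by ring.
  by rewrite H; ring.
(* The power z^(c - 1) may blow up, but [v] vanishes to first order: [Phi] is z^c times the bounded
   factors v(z) / z and (1 + z)^(1 - m). *)
have Phi0 : Phi z @[z --> 0^'+] --> 0.
  have H1 : z `^ c @[z --> (0 : R)^'+] --> (0 : R) by exact: powR_cvg0.
  have H2 : z^-1 * v z @[z --> (0 : R)^'+] --> dv 0.
    have /dvE [] : 0 <= (0 : R) <= Z by rewrite lexx ltW.
    move=> /[swap] <-; rewrite /derivable /derive v0 => /cvg_dnbhs_at_right H.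
    apply: cvg_trans H; apply: near_eq_cvg; near=> h.
    by rewrite /= addr0 subr0 /GRing.scale/= mulr1.
  have H3 : (1 + z) `^ (1 - m) @[z --> (0 : R)^'+] --> (1 : R).
    suff : (1 + z) `^ (1 - m) @[z --> (0 : R)^'+] --> (1 : R) `^ (1 - m) by rewrite powR1.
    apply: cvg_powR => //.
    apply: cvg_at_right_filter; rewrite -[X in _ --> X](addr0 1).
    by apply: cvgD; [exact: cvg_cst|exact: cvg_id].
  have H4 : z `^ c * (1 + z) `^ (1 - m) * (z^-1 * v z) @[z --> (0 : R)^'+] --> (0 * 1 * dv 0 : R).
    by apply: cvgM => //; apply: cvgM.
  rewrite !mul0r in H4; apply: cvg_trans H4; apply: near_eq_cvg; near=> z.
  have z0 : 0 < z by near: z; exact: nbhs_right_gt.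
  rewrite /Phi /= -(mulr_powRB1 (ltW z0) c0); move: (z `^ (c - 1)) ((1 + z) `^ (1 - m)) (v z) => P Q V.
  by field; rewrite gt_eqF.
suff HPhi : Phi Z = (m - 1) * (Z `^ c * beta_kernel c m Z).
  have Z10 : 0 < 1 + Z by rewrite addr_gt0.
  have P0 := powR_gt0 (c - 1) Z0; have Q0 := powR_gt0 (1 - m) Z10.
  move: HPhi; rewrite /Phi -(mulr_powRB1 (ltW Z0) c0).
  rewrite (_ : m - 1 = - (1 - m)); last by ring.
  rewrite (powRN (1 + Z)); move: (Z `^ (c - 1)) ((1 + Z) `^ (1 - m)) P0 Q0 (beta_kernel c m Z) => P Q P0 Q0 K H.
  apply: (@mulfI _ (P * Q)); first by rewrite mulf_neq0 ?gt_eqF.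
  by rewrite H; field; rewrite gt_eqF.
(* For m = 1 one cannot divide by m - 1, but [Phi] is then constant on []0, Z]], hence equal to its
   limit 0. *)
have [m1|m1] := eqVneq m 1.
  rewrite m1 subrr mul0r.
  have cst z : 0 < z -> z <= Z -> Phi z = Phi Z.
    move=> z0; rewrite le_eqVlt => /orP[/eqP -> //|zZ].
    have [||x xzZ H] := @MVT _ Phi (fun z => (m - 1) * phi z) z Z zZ.
    - move=> x; rewrite in_itv/= => /andP[zx xZ].
      by apply: dPhi; [exact: lt_trans zx|exact: ltW].
    - apply: derivable_within_continuous => x; rewrite in_itv/= => /andP[zx xZ].
      by have [] := dPhi x (lt_le_trans z0 zx) xZ.
    - by apply/eqP; rewrite eq_sym -subr_eq0 H m1 subrr !mul0r.
  apply/esym; apply: (cvg_unique _ Phi0) => //.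
  apply: cvg_near_cst; near=> z; apply: cst.
    by near: z; exact: nbhs_right_gt.
  by near: z; exact: nbhs_right_le.
have m10 : m - 1 != 0 by rewrite subr_eq0.
(* The factor m - 1, possibly negative, is divided out to leave the nonnegative integrand [phi]. *)
have : (\int[mu]_(t in `]0%R, Z]) (phi t)%:E)%E = ((m - 1)^-1 * Phi Z)%:E.
  apply: (@ge0_FTC_at0 _ phi (fun z => (m - 1)^-1 * Phi z)) => //.
  - move=> x x0 _; apply: cvgM.
      have /derivable1_diffP/differentiable_continuous : derivable (fun z : R => z `^ (c - 1)) x 1.
        by apply: derivable_powR; rewrite in_itv/= x0.
      exact.
    apply: cvg_powR; first by rewrite addr_gt0.
    by apply: cvgD; [exact: cvg_cst|exact: cvg_id].
  - by move=> x _ _; rewrite mulr_ge0 ?powR_ge0.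
  - move=> x x0 xZ; have dP := dPhi x x0 xZ.
    rewrite (_ : (fun z => _) = (m - 1)^-1 \*: Phi)//.
    by apply: is_derive_eq; rewrite /GRing.scale/= mulKf.
  - by rewrite -[X in _ --> X](mulr0 (m - 1)^-1); apply: cvgMr.
rewrite incomplete_betaE// => -[] ->.
by rewrite mulVKf.
Unshelve. all: by end_near. Qed.

(* The Gauss series (z < 1) and the Pfaff branch (1 <= z) obey the same equation. *)
Lemma hyp2F1_beta_kernel b c z : 0 < c -> 0 < z -> hyp2F1 1 b c (- z) =
  (1 + (c - b) * (z * (1 + z) `^ (c - b) * beta_kernel c (1 + c - b) z)) / (1 + z).
Proof.
move=> c0 z0; have z10 : 0 < 1 + z by rewrite addr_gt0.
have mE : 1 + c - b - 1 = c - b by ring.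
rewrite /hyp2F1 ltrN2 !gauss_series1; case: ifPn => [z1|].
  have H x : `|x| < 1 -> _ := is_derive_pseries (subgeometric_hyp_coef b c0) (x := x).
  pose F x := limn (pseries (hyp_coef b c) x).
  pose G x := limn (pseries (pseries_diffs (hyp_coef b c)) x).
  have N1 t : 0 <= t <= z -> `|- t| < 1.
    by move=> /andP[t0 tz]; rewrite normrN ger0_norm// (le_lt_trans tz).
  (* The solution [v] is (1 + t) F(-t) - 1: it vanishes at 0 and inherits its equation from
     [hyp_ode]. *)
  have -> : (c - b) * (z * (1 + z) `^ (c - b) * beta_kernel c (1 + c - b) z) =
    (1 + z) * F (- z) - 1; last by rewrite addrC subrK mulrC mulKf// gt_eqF.
  rewrite -mE; apply/esym; apply: (@incomplete_beta_ode _ _ _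
    (fun t => (1 + t) * F (- t) - 1) (fun t => F (- t) - (1 + t) * G (- t))) => //.
  - move=> t /N1 t1.
    have d1 : is_derive (- t) 1 F (G (- t)) by exact: H.
    have d2 : is_derive t 1 (fun t => F (- t)) (- G (- t)).
      have dN : is_derive t 1 (fun t : R => - t) (- 1) by apply: is_derive_eq.
      by have := is_derive1_comp d1 dN; rewrite mulrN1.
    rewrite (_ : (fun t => _) = (cst 1 + id) * (fun t => F (- t)) - cst 1)//.
    by apply: is_derive_eq; rewrite /GRing.scale/= !fctE; ring.
  - by rewrite oppr0 addr0 mul1r /F hyp_at0 subrr.
  - move=> t /andP[t0 tz]; have /N1 t1 : 0 <= t <= z by rewrite (ltW t0).
    have := hyp_ode b c0 t1; rewrite -/(F (- t)) -/(G (- t)).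
    move: (F _) (G _) => f g E.
    transitivity ((1 + t) * ((1 - - t) * - t * g + (c - 1 - b * - t) * f) - (c - 1) * (1 + t) + (c - b) * t); first by ring.
    by rewrite E; ring.
rewrite -leNgt => z1.
(* Pfaff's prefactor is the 1 / (1 + z) of the claim, so [v] is now F(t / (1 + t)) - 1. As t / (1 +
   t) < 1 for every t >= 0, the equation holds from 0 on, not only where this branch defines the
   function. *)
have H x : `|x| < 1 -> _ := is_derive_pseries (subgeometric_hyp_coef (c - b) c0) (x := x).
pose F x := limn (pseries (hyp_coef (c - b) c) x).
pose G x := limn (pseries (pseries_diffs (hyp_coef (c - b) c)) x).
have N1 t : 0 <= t -> `|t / (1 + t)| < 1.
  move=> t0; have t10 : 0 < 1 + t by lra.
  by rewrite ger0_norm ?divr_ge0// ?(ltW t10)// ltr_pdivrMr// mul1r; lra.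
have -> : (c - b) * (z * (1 + z) `^ (c - b) * beta_kernel c (1 + c - b) z) =
    F (z / (1 + z)) - 1; last first.
  rewrite [1 + (_ - 1)]addrC subrK opprK powR_inv1 ?ltW// mulrC; congr (F _ / _).
  by rewrite -opprD invrN mulrNN [z + 1]addrC.
rewrite -mE; apply/esym; apply: (@incomplete_beta_ode _ _ _
  (fun t => F (t / (1 + t)) - 1) (fun t => G (t / (1 + t)) / (1 + t) ^+ 2)) => //.
- move=> t /andP[t0 _]; have t1 := N1 t t0; have t10 : 0 < 1 + t by lra.
  have d1 : is_derive (t / (1 + t)) 1 F (G (t / (1 + t))) by exact: H.
  have d2 : is_derive t 1 (fun t : R => t / (1 + t)) ((1 + t) ^- 2).
    rewrite (_ : (fun t => _) = id * (fun t => (1 + t)^-1))//.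
    have d3 : is_derive t 1 (fun t : R => (1 + t)^-1) (- (1 + t) ^- 2).
      have dp := is_derive_1D t.
      have t1n : 1 + t != 0 by rewrite gt_eqF.
      have := is_deriveV t1n dp.
      by rewrite /GRing.scale/= mulr1.
    by apply: is_derive_eq; rewrite /GRing.scale/=; field; rewrite gt_eqF.
  have d3 := @is_derive1_comp _ F (fun t : R => t / (1 + t)) t _ _ d1 d2.
  rewrite (_ : (fun t => _) = (F \o (fun t : R => t / (1 + t))) - cst 1)//.
  by apply: is_derive_eq; rewrite subr0.
- by rewrite mul0r /F hyp_at0 subrr.
- move=> t /andP[t0 tz]; have t1 := N1 t (ltW t0); have t10 : 0 < 1 + t by lra.
  have := hyp_ode (c - b) c0 t1; rewrite -/(F _) -/(G _).
  move: (F _) (G _) => f g E.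
  transitivity ((1 + t) * ((1 - t / (1 + t)) * (t / (1 + t)) * g + (c - 1 - (c - b) * (t / (1 + t))) * f)
    - (c - 1) * (1 + t) + (c - b) * t); first by field; rewrite gt_eqF.
  by rewrite E; ring.
Qed.

End Hypergeometric.

(** * The mean of the hypergeometric kernel *)

Section MeanKernel.
Context {R : realType}.
Local Notation mu := (@lebesgue_measure R).
Local Notation Rp := (`]0%R, +oo[%classic : set R).
Implicit Types a b c h l m p q s t u v x y z : R.

#[local] Opaque powR Gamma_pos beta_kernel.

Lemma measurable_affine_powR p q m (D : set R) :
  measurable_fun D (fun z : R => (p + z * q) `^ m).
Proof.
apply/measurable_funTS/(measurableT_comp (measurable_powR m)).
by apply: measurable_funD; [exact: measurable_cst|exact: mulrr_measurable].
Qed.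

(** For m >= 0 the kernel is nonincreasing in z >= 0; replacing z by max(z, 0) extends the
    monotonicity to the whole line. *)
Lemma measurable_beta_kernel c m : 0 < c -> 0 <= m -> measurable_fun Rp (beta_kernel c m).
Proof.
move=> c0 m0; pose K z := beta_kernel c m (Num.max z 0).
have -> : measurable_fun Rp (beta_kernel c m) = measurable_fun Rp K.
  apply/propext; split; apply: eq_measurable_fun => z /set_mem /=;
  by rewrite in_itv/= andbT => z0; rewrite /K max_l// ltW.
apply: measurable_funTS; apply: (@nonincreasing_measurable _ setT); first exact: measurableT.
move=> y z yz.
have M0 x : 0 <= Num.max x 0 by rewrite le_max lexx orbT.
have Myz : Num.max y 0 <= Num.max z 0 by rewrite ge_max !le_max yz lexx !orbT.
rewrite /K; move: (Num.max y 0) (Num.max z 0) (M0 y) (M0 z) Myz.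
move=> {K yz M0} {}y {}z y0 z0 yz.
suff : ((beta_kernel c m z)%:E <= (beta_kernel c m y)%:E)%E by rewrite lee_fin.
have Ez := beta_kernelE m c0 z0; have Ey := beta_kernelE m c0 y0.
rewrite Ez Ey {Ez Ey}.
apply: ge0_le_integral.
- exact: measurable_itv.
- by move=> s _; rewrite lee_fin mulr_ge0 ?powR_ge0.
- by have /integrableP[] := integrable_kernel m c0 z0.
- by have /integrableP[] := integrable_kernel m c0 y0.
move=> s /=; rewrite in_itv/= => /andP[s0 s1].
rewrite lee_fin ler_wpM2l ?powR_ge0// !powRN lef_pV2 ?posrE ?powR_gt0//; last 2 first.
- by rewrite ltr_pwDl// mulr_ge0// ltW.
- by rewrite ltr_pwDl// mulr_ge0// ltW.
apply: ge0_ler_powR => //; rewrite ?nnegrE ?addr_ge0 ?mulr_ge0 ?(ltW s0)//.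
by rewrite lerD2l ler_wpM2r// ltW.
Qed.

Lemma integral_powR_shift k l h e d : 0 < l -> l < h -> 0 <= d ->
  (\int[mu]_(s in `[l, h]) (k * e * (s + d) `^ (e - 1))%:E =
   (k * ((h + d) `^ e - (l + d) `^ e))%:E)%E.
Proof.
move=> l0 lh d0; pose F s := k * (s + d) `^ e.
have dF x : l <= x -> is_derive x 1 F (k * e * (x + d) `^ (e - 1)).
  move=> lx; have xd : 0 < x + d by rewrite ltr_wpDr// (lt_le_trans l0).
  have d1 := is_derive1_powR e xd.
  have d2 : is_derive x 1 (fun s : R => s + d) 1.
    rewrite (_ : (fun s => _) = id + cst d)//.
    by apply: is_derive_eq; rewrite addr0.
  have d3 := @is_derive1_comp _ (fun s => s `^ e) (fun s => s + d) x _ _ d1 d2.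
  rewrite (_ : F = k \*: ((fun s => s `^ e) \o (fun s => s + d)))//.
  by apply: is_derive_eq; rewrite /GRing.scale/= mulr1 mulrA.
have cF x : l <= x -> {for x, continuous F}.
  by move=> lx; apply/differentiable_continuous/derivable1_diffP; have [] := dF x lx.
rewrite (@continuous_FTC2 _ _ F)//.
- by rewrite -EFinB -mulrBr.
- apply: continuous_in_subspaceT => x /set_mem /=; rewrite in_itv/= => /andP[lx _].
  have xd : 0 < x + d by rewrite ltr_wpDr// (lt_le_trans l0).
  apply: cvgMr; apply: cvg_powR => //.
  by apply: cvgD; [exact: cvg_id|exact: cvg_cst].
- split.
  + by move=> x; rewrite in_itv/= => /andP[lx _]; have [] := dF x (ltW lx).
  + by apply: cvg_at_right_filter; exact: cF.
  + by apply: cvg_at_left_filter; apply: cF; exact: ltW.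
- move=> x; rewrite in_itv/= => /andP[lx _]; rewrite derive1E.
  by apply: derive_val; apply: dF; exact: ltW.
Qed.

(** Put m = a + c - 1. Each power alone gives an integrand of order t^(-a) at infinity, not
    integrable if a <= 1. The difference is therefore written as the integral of m (s + t q)^(-m -
    1) over s in [[l, h]]; after the exchange the inner integral is a beta integral proportional to
    s^(-a). [S] is the integral of s^(-a) over [[l, h]], a logarithm when a = 1, a case that the
    factor 1 - a lets the same identity cover. *)
Lemma beta_difference a c q l h : 0 < a -> 0 < c -> 0 < a + c - 1 ->
  0 < q -> 0 < l -> l < h -> exists S,
  (\int[mu]_(t in Rp) (t `^ (c - 1) * ((l + t * q) `^ (- (a + c - 1)) - (h + t * q) `^ (- (a + c - 1))))%:E =
   ((a + c - 1) * (Gamma_pos a * Gamma_pos c / Gamma_pos (a + c)) * q `^ (- c) * S)%:E)%E /\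
  (1 - a) * S = h `^ (1 - a) - l `^ (1 - a).
Proof.
move=> a0 c0; set m := a + c - 1 => m0 q0 l0 lh.
have h0 := lt_trans l0 lh.
pose S := \int[mu]_(s in `[l, h]) (s `^ (- a)).
have cS : {within `[l, h], continuous (fun s : R => s `^ (- a))}.
  apply: continuous_in_subspaceT => x /set_mem /=; rewrite in_itv/= => /andP[lx _].
  by apply: cvg_powR; [exact: lt_le_trans lx|exact: cvg_id].
have iS : mu.-integrable `[l, h] (fun s : R => (s `^ (- a))%:E).
  by apply: continuous_compact_integrable => //; exact: segment_compact.
exists S; split; last first.
  have := @integral_powR_shift 1 l h (1 - a) 0 l0 lh (lexx _).
  rewrite !addr0 !mul1r => /(congr1 fine) /= <-.
  rewrite -RintegralZl; [|exact: measurable_itv|exact: iS].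
  congr fine; apply: eq_integral => s _.
  by rewrite addr0; congr (_ * _ `^ _)%:E; ring.
pose B := Gamma_pos a * Gamma_pos c / Gamma_pos (a + c).
transitivity (\int[mu]_(t in Rp) \int[mu]_(s in `[l, h])
   (m * (t `^ (c - 1) * (s + t * q) `^ (- (a + c))))%:E)%E.
  apply: eq_integral => t /set_mem /=; rewrite in_itv/= andbT => t0.
  have tq0 : 0 <= t * q by rewrite mulr_ge0// ltW.
  rewrite (_ : _ * _ = - t `^ (c - 1) * ((h + t * q) `^ (- m) - (l + t * q) `^ (- m))); last by ring.
  rewrite -integral_powR_shift//; apply: eq_integral => s _; congr EFin.
  rewrite (_ : - m - 1 = - (a + c)); last by rewrite /m; ring.
  by ring.
rewrite tonelli_on//; last 2 first.
- apply/measurable_EFinP/measurable_funTS; apply: measurable_funM; first exact: measurable_cst.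
  apply: measurable_funM; first exact: (measurableT_comp (measurable_powR (c - 1))).
  apply: (measurableT_comp (measurable_powR (- (a + c)))).
  by apply: measurable_funD => //; exact: measurable_funM.
- by move=> t s _ _; rewrite lee_fin !mulr_ge0 ?powR_ge0// ltW.
transitivity (\int[mu]_(s in `[l, h]) ((m * B * q `^ (- c)) * s `^ (- a))%:E)%E.
  apply: eq_integral => s /set_mem /=; rewrite in_itv/= => /andP[ls _].
  have s0 := lt_le_trans l0 ls.
  rewrite ge0_RintegralZl//; last 3 first.
  - apply: measurable_funM; last exact: measurable_affine_powR.
    by apply: measurable_funTS; exact: measurable_powR.
  - by move=> t _; rewrite mulr_ge0 ?powR_ge0.
  - exact: ltW.
  by rewrite beta_integral// -EFinM; congr EFin; rewrite -/B; ring.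
under eq_integral do rewrite EFinM.
rewrite integralZl; [|exact: measurable_itv|exact: iS].
rewrite -/B [RHS]EFinM; congr (_ * _)%E.
by rewrite /S /Rintegral fineK//; exact: integrable_fin_num.
Qed.

(** Up to the constant (m - 1) (p - q) the integrand is the derivative of ((1 + z) / (p + z q))^(m -
    1), and that quotient tends to 1 / q at infinity. *)
Lemma kernel_tail m p q t : 0 < p -> 0 < q -> p != q -> m != 1 -> 0 < t ->
  (\int[mu]_(z in `[t, +oo[) ((1 + z) `^ (m - 2) * (p + z * q) `^ (- m))%:E =
   ((q `^ (1 - m) - ((1 + t) / (p + t * q)) `^ (m - 1)) / ((m - 1) * (p - q)))%:E)%E.
Proof.
move=> p0 q0 pq m1 t0.
have pz z : 0 < z -> 0 < p + z * q by move=> z0; rewrite addr_gt0// mulr_gt0.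
have m10 : m - 1 != 0 by rewrite subr_eq0.
have pq0 : p - q != 0 by rewrite subr_eq0.
have k0 : (m - 1) * (p - q) != 0 by rewrite mulf_neq0.
pose r z := (1 + z) / (p + z * q).
have r0 z : 0 < z -> 0 < r z by move=> z0; rewrite divr_gt0 ?pz// addr_gt0.
pose F z := ((m - 1) * (p - q))^-1 * r z `^ (m - 1).
pose w z := (1 + z) `^ (m - 2) * (p + z * q) `^ (- m).
have dr z : 0 < z -> is_derive z 1 r ((p - q) / (p + z * q) ^+ 2).
  move=> z0; have pz0 := pz z z0.
  have d1 : is_derive z 1 (fun t : R => 1 + t) 1.
    by rewrite (_ : (fun s => _) = cst 1 + id)//; apply: is_derive_eq; rewrite add0r.
  have d2 : is_derive z 1 (fun t : R => p + t * q) q.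
    rewrite (_ : (fun s => _) = cst p + q \*: id).
      by apply: is_derive_eq; rewrite add0r /GRing.scale/= mulr1.
    by apply/funext => y; rewrite /= /GRing.scale/= mulrC.
  have pzn : p + z * q != 0 by rewrite gt_eqF.
  have d3 := @is_deriveV R (fun t : R => p + t * q) z q 1 pzn d2.
  rewrite /r (_ : (fun z => _) = (fun t : R => 1 + t) * (fun t => (p + t * q)^-1))//.
  by apply: is_derive_eq; rewrite /GRing.scale/=; field.
have dF z : 0 < z -> is_derive z 1 F (w z).
  move=> z0; have pz0 := pz z z0; have z10 : 0 < 1 + z by rewrite addr_gt0.
  have d1 := is_derive1_powR (m - 1) (r0 z z0).
  have d2 := @is_derive1_comp _ (fun s => s `^ (m - 1)) r z _ _ d1 (dr z z0).
  rewrite /F (_ : (fun z => _) = ((m - 1) * (p - q))^-1 \*: ((fun s => s `^ (m - 1)) \o r))//.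
  apply: is_derive_eq; rewrite /GRing.scale/= /w /r.
  rewrite powRM ?invr_ge0 ?(ltW z10) ?(ltW pz0)//.
  rewrite -(powR_inv1 (ltW pz0)) -powRrM.
  rewrite (_ : m - 1 - 1 = m - 2); last by ring.
  rewrite (_ : - m = - 1 * (m - 2) + - 1 + - 1); last by ring.
  rewrite !gt0_powRD// powR_inv1 ?(ltW pz0)//.
  move: ((1 + z) `^ _) ((p + z * q) `^ _) => A B.
  by field; rewrite m10 pq0 gt_eqF.
have dc (f : R -> R) x d : is_derive x 1 f d -> {for x, continuous f}.
  by move=> [/derivable1_diffP/differentiable_continuous].
rewrite (@ge0_continuous_FTC2y _ w F t (((m - 1) * (p - q))^-1 * q `^ (1 - m))).
- by rewrite -EFinB -mulrBr mulrC.
- by move=> z _; rewrite mulr_ge0 ?powR_ge0.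
- apply: continuous_in_subspaceT => z /set_mem /=; rewrite in_itv/= andbT => tz.
  have z0 : 0 < z by exact: lt_le_trans tz.
  apply: cvgM.
    apply: cvg_powR; first by rewrite addr_gt0.
    by apply: cvgD; [exact: cvg_cst|exact: cvg_id].
  apply: cvg_powR; first exact: pz.
  by apply: cvgD; [exact: cvg_cst|apply: cvgM; [exact: cvg_id|exact: cvg_cst]].
- apply: cvgMr; rewrite (_ : 1 - m = - (1) * (m - 1)); last by ring.
  rewrite powRrM powR_inv1 ?(ltW q0)//.
  apply: cvg_powR; first by rewrite invr_gt0.
  have : q^-1 + (1 - p / q) * (p + z * q)^-1 @[z --> +oo] --> q^-1 + (1 - p / q) * 0.
    apply: cvgD; first exact: cvg_cst.
    apply: cvgMr; apply/gtr0_cvgV0.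
      by near=> z; apply: pz; near: z; exact: nbhs_pinfty_gt.
    apply: (@cvg_comp _ _ _ (fun z : R => z * q) (fun y => p + y) _ +oo).
      exact: gt0_cvgMly.
    exact: cvg_addrl.
  rewrite mulr0 addr0; apply: cvg_trans; apply: near_eq_cvg; near=> z.
  have z0 : 0 < z by near: z; apply: nbhs_pinfty_gt.
  by rewrite /r; field; rewrite !gt_eqF// pz.
- by move=> z tz; have [] := dF z (lt_trans t0 tz).
- by apply: cvg_at_right_filter; apply: (dc _ _ _ (dF _ _)).
- move=> z; rewrite in_itv/= andbT => tz; rewrite derive1E.
  by apply: derive_val; apply: dF; exact: lt_trans tz.
Unshelve. all: by end_near. Qed.

(** z^c times the kernel is the incomplete beta integral over []0, z]], so this is Tonelli on the
    triangle t <= z. *)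
Lemma kernel_swap c m (w : R -> R) : 0 < c -> measurable_fun [set: R] w ->
  (forall z, 0 <= w z) ->
  (\int[mu]_(z in Rp) (w z * (z `^ c * beta_kernel c m z))%:E =
   \int[mu]_(t in Rp) ((t `^ (c - 1) * (1 + t) `^ (- m))%:E * \int[mu]_(z in `[t, +oo[) (w z)%:E))%E.
Proof.
move=> c0 mw w0.
have mphi (D : set R) : measurable_fun D (fun t : R => t `^ (c - 1) * (1 + t) `^ (- m)).
  apply: measurable_funM; first by apply: measurable_funTS; exact: measurable_powR.
  by have := @measurable_affine_powR 1 1 (- m) D; under eq_fun do rewrite mulr1.
transitivity (\int[mu]_(z in Rp) \int[mu]_(t in Rp)
   (if t <= z then w z * (t `^ (c - 1) * (1 + t) `^ (- m)) else 0)%:E)%E.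
  apply: eq_integral => z /set_mem /=; rewrite in_itv/= andbT => z0.
  rewrite (@integral_if R Rp `]0, z]%classic (fun t => t <= z)); last first.
    by move=> t /=; rewrite !in_itv/= andbT; split=> [/andP[]|[-> ->]].
  rewrite ge0_RintegralZl//; last by move=> t _; rewrite mulr_ge0 ?powR_ge0.
  by rewrite incomplete_betaE.
rewrite tonelli_on//; last 2 first.
- apply/measurable_EFinP/measurable_funTS/measurable_fun_ifT.
  + exact: measurable_fun_ler.
  + apply: measurable_funM; first exact: (measurableT_comp mw).
    apply: (measurableT_comp (mphi setT)); exact: measurable_snd.
  + exact: measurable_cst.
- by move=> z t _ _; rewrite lee_fin; case: ifPn => // _; rewrite !mulr_ge0 ?powR_ge0.
apply: eq_integral => t /set_mem /=; rewrite in_itv/= andbT => t0.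
rewrite (@integral_if R Rp `[t, +oo[%classic (fun z => t <= z)); last first.
  move=> z /=; rewrite !in_itv/= !andbT; split=> [tz|[]//]; split => //.
  exact: lt_le_trans tz.
under eq_integral do rewrite mulrC.
rewrite ge0_RintegralZl ?mulr_ge0 ?powR_ge0//.
exact: measurable_funTS.
Qed.

Lemma ge0_integrable_Rp (f : R -> R) r : measurable_fun Rp f ->
  (forall x, 0 < x -> 0 <= f x) -> (\int[mu]_(x in Rp) (f x)%:E = r%:E)%E ->
  mu.-integrable Rp (EFin \o f).
Proof.
move=> mf f0 fr; apply/integrableP; split; first exact/measurable_EFinP.
have -> : (\int[mu]_(x in Rp) `|(EFin \o f) x| = \int[mu]_(x in Rp) (f x)%:E)%E.
  apply: eq_integral => x /set_mem /=; rewrite in_itv/= andbT => x0.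
  by rewrite ger0_norm ?f0.
by rewrite fr ltry.
Qed.

(** The hypergeometric value is 1 / (1 + z) plus m - 1 times z (1 + z)^(m - 2) [beta_kernel]. The
    two parts give [j1] and [j2], integrals of nonnegative functions; the sign of m - 1 enters only
    afterwards. The factor a - 1 stays on the left because at a = 1 the bracket on the right is
    0. *)
Lemma mean_kernel a c p q : 0 < a -> 0 < c -> 0 < a + c - 1 ->
  0 < p -> 0 < q -> p != q ->
  let m := a + c - 1 in exists j1 j2,
  [/\ (\int[mu]_(z in Rp) (z `^ (c - 1) * (1 + z)^-1 * (p + z * q) `^ (- m))%:E = j1%:E)%E,
      (\int[mu]_(z in Rp) ((1 + z) `^ (m - 2) * (p + z * q) `^ (- m) *
         (z `^ c * beta_kernel c m z))%:E = j2%:E)%E &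
      (a - 1) * (p - q) * (j1 + (m - 1) * j2) * Gamma_pos m =
      Gamma_pos a * Gamma_pos c * q `^ (1 - c) * (q `^ (1 - a) - p `^ (1 - a))].
Proof.
move=> a0 c0 ac0 p0 q0 pq m; have m0 : 0 < m by [].
(* Since p + z q >= mn (1 + z), the power (p + z q)^(-m) is at most C (1 + z)^(-m). *)
pose mn := Num.min p q; have mn0 : 0 < mn by rewrite lt_min p0.
pose C := mn `^ (- m); have C0 : 0 < C by exact: powR_gt0.
pose phi t := t `^ (c - 1) * (1 + t) `^ (- m).
pose w z := (1 + z) `^ (m - 2) * (p + z * q) `^ (- m).
(* The weight [w] with p = 2, q = 1 and m = 2, whose tail integral is 1 / (2 + t). It dominates [w]
   up to the factor 4 C, since w <= C (1 + z)^(-2) and 2 + z <= 2 (1 + z), and so proves [j2] finite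
   for every m > 0, including m = 1. *)
pose w2 z := (1 + z) `^ (2 - 2) * (2 + z * 1) `^ (- 2).
pose P1 z := z `^ (c - 1) * (1 + z)^-1 * (p + z * q) `^ (- m).
pose bt t := t `^ (c - 1) * (1 + t * 1) `^ (- (a + c)).
have mpow e D : measurable_fun D (fun z : R => z `^ e).
  by apply: measurable_funTS; exact: measurable_powR.
have m1D e (D : set R) : measurable_fun D (fun z : R => (1 + z) `^ e).
  by have := @measurable_affine_powR 1 1 e D; under eq_fun do rewrite mulr1.
have mV d : 0 < d -> measurable_fun Rp (fun z : R => (d + z)^-1).
  move=> d0; apply: (eq_measurable_fun (fun z : R => (d + z * 1) `^ (-1))); last exact: measurable_affine_powR.
  move=> z /set_mem /=; rewrite in_itv/= andbT mulr1 => z0.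
  by rewrite powR_inv1// addr_ge0// ltW.
have mP1 : measurable_fun Rp P1.
  apply: measurable_funM; last exact: measurable_affine_powR.
  apply: measurable_funM; first exact: mpow.
  exact: mV.
have mw D : measurable_fun D w.
  by apply: measurable_funM; [exact: m1D|exact: measurable_affine_powR].
have mw2 D : measurable_fun D w2.
  by apply: measurable_funM; [exact: m1D|exact: measurable_affine_powR].
have mbt D : measurable_fun D bt.
  by apply: measurable_funM; [exact: mpow|exact: measurable_affine_powR].
have mphi D : measurable_fun D phi.
  by apply: measurable_funM; [exact: mpow|exact: m1D].
have mK : measurable_fun Rp (fun z => z `^ c * beta_kernel c m z).
  by apply: measurable_funM; [exact: mpow|apply: measurable_beta_kernel => //; exact: ltW].
have K0 z : 0 < z -> 0 <= z `^ c * beta_kernel c m z.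
  move=> z0; rewrite mulr_ge0 ?powR_ge0// -lee_fin beta_kernelE ?(ltW z0)//.
  by apply: integral_ge0 => s _; rewrite lee_fin mulr_ge0 ?powR_ge0.
have pqC z : 0 < z -> (p + z * q) `^ (- m) <= C * (1 + z) `^ (- m).
  move=> z0; rewrite /C -powRM ?(ltW mn0) ?addr_ge0 ?(ltW z0)//.
  have h1 : 0 < mn * (1 + z) by rewrite mulr_gt0// addr_gt0.
  have h2 : mn * (1 + z) <= p + z * q.
    rewrite mulrDr mulr1 lerD ?ge_min ?lexx// mulrC ler_pM2l//.
    by rewrite ge_min lexx orbT.
  have h3 := lt_le_trans h1 h2.
  rewrite !powRN lef_pV2 ?posrE ?powR_gt0//.
  by apply: ge0_ler_powR => //; rewrite ?nnegrE; exact: ltW.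
have fbt : (\int[mu]_(z in Rp) (bt z)%:E < +oo)%E by rewrite beta_integral// ltry.
have fphi : (\int[mu]_(z in Rp) (phi z * (1 + z)^-1)%:E < +oo)%E.
  have -> : (\int[mu]_(z in Rp) (phi z * (1 + z)^-1)%:E = \int[mu]_(z in Rp) (bt z)%:E)%E; last exact: fbt.
  apply: eq_integral => z /set_mem /=.
  rewrite in_itv/= andbT => z0; congr EFin; have z10 : 0 < 1 + z by rewrite addr_gt0.
  rewrite /phi /bt mulr1 -powR_inv1 ?(ltW z10)// -mulrA -gt0_powRD//.
  by congr (_ * _ `^ _); rewrite /m; ring.
have f1 : (\int[mu]_(z in Rp) (P1 z)%:E < +oo)%E.
  apply: (@le_lt_trans _ _ (\int[mu]_(z in Rp) (C * (phi z * (1 + z)^-1))%:E)%E).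
    apply: ge0_le_integral => //.
    - move=> z; rewrite /= in_itv/= andbT => z0.
      by rewrite lee_fin !mulr_ge0 ?powR_ge0// invr_ge0 addr_ge0// ltW.
    - exact/measurable_EFinP.
    - apply/measurable_EFinP; apply: measurable_funM; first exact: measurable_cst.
      apply: measurable_funM; first exact: mphi.
      exact: mV.
    - move=> z; rewrite /= in_itv/= andbT => z0; rewrite lee_fin /P1 /phi.
      have -> : C * (z `^ (c - 1) * (1 + z) `^ (- m) / (1 + z)) =
        z `^ (c - 1) / (1 + z) * (C * (1 + z) `^ (- m)) by ring.
      by rewrite ler_wpM2l ?pqC// mulr_ge0 ?powR_ge0// invr_ge0 addr_ge0// ltW.
  rewrite ge0_RintegralZl.
  - by rewrite lte_mul_pinfty// lee_fin ltW.
  - exact: measurable_itv.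
  - apply: measurable_funM; first exact: mphi.
    exact: mV.
  - move=> z; rewrite /= in_itv/= andbT => z0.
    by rewrite !mulr_ge0 ?powR_ge0// invr_ge0 addr_ge0// ltW.
  - exact: ltW.
have f2 : (\int[mu]_(z in Rp) (w z * (z `^ c * beta_kernel c m z))%:E < +oo)%E.
  apply: (@le_lt_trans _ _ (\int[mu]_(z in Rp) (4 * C * (w2 z * (z `^ c * beta_kernel c m z)))%:E)%E).
    apply: ge0_le_integral => //.
    - move=> z; rewrite /= in_itv/= andbT => z0.
      by rewrite lee_fin mulr_ge0 ?K0// mulr_ge0 ?powR_ge0.
    - by apply/measurable_EFinP; apply: measurable_funM; [exact: mw|exact: mK].
    - apply/measurable_EFinP; apply: measurable_funM; first exact: measurable_cst.
      by apply: measurable_funM; [exact: mw2|exact: mK].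
    - move=> z; rewrite /= in_itv/= andbT => z0; rewrite lee_fin [leRHS]mulrA ler_wpM2r ?K0//.
      have z10 : 0 < 1 + z by rewrite addr_gt0.
      have z20 : 0 < 2 + z by rewrite addr_gt0.
      apply: (@le_trans _ _ (C * (1 + z) `^ (- 2))).
        have -> : (1 + z) `^ (- 2) = (1 + z) `^ (m - 2) * (1 + z) `^ (- m).
          by rewrite -gt0_powRD//; congr (_ `^ _); ring.
        by rewrite /w mulrCA ler_wpM2l ?powR_ge0 ?pqC.
      rewrite /w2 subrr powRr0 mul1r mulr1 -mulrA mulrCA ler_pM2l//.
      rewrite !powR_invn ?(ltW z10) ?(ltW z20)// ler_pdivlMr ?exprn_gt0//.
      rewrite mulrC ler_pdivrMr ?exprn_gt0//; nra.
  rewrite ge0_RintegralZl.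
  - rewrite lte_mul_pinfty// ?lee_fin ?mulr_ge0 ?(ltW C0)//.
    rewrite kernel_swap//; last by move=> z; rewrite mulr_ge0 ?powR_ge0.
    apply: (@le_lt_trans _ _ (\int[mu]_(t in Rp) (phi t * (2 + t)^-1)%:E)%E).
      rewrite le_eqVlt; apply/orP; left; apply/eqP; apply: eq_integral => t /set_mem /=; rewrite in_itv/= andbT => t0.
      rewrite kernel_tail//; [|lra|lra].
      rewrite -EFinM; congr EFin; rewrite /phi; congr (_ * _).
      rewrite powR1 (_ : 2 - 1 = 1); last by ring.
      rewrite powRr1 ?divr_ge0 ?addr_ge0 ?mulr_ge0 ?(ltW t0)//.
      by field; rewrite gt_eqF// addr_gt0.
    apply: le_lt_trans fphi; apply: ge0_le_integral.
    + exact: measurable_itv.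
    + move=> t; rewrite /= in_itv/= andbT => t0.
      by rewrite lee_fin !mulr_ge0 ?powR_ge0// invr_ge0 addr_ge0// ltW.
    + by apply/measurable_EFinP; apply: measurable_funM; [exact: mphi|exact: mV].
    + by apply/measurable_EFinP; apply: measurable_funM; [exact: mphi|exact: mV].
    + move=> t; rewrite /= in_itv/= andbT => t0.
      rewrite lee_fin ler_wpM2l ?mulr_ge0 ?powR_ge0//.
      by rewrite lef_pV2 ?posrE; lra.
  - exact: measurable_itv.
  - by apply: measurable_funM; [exact: mw2|exact: mK].
  - by move=> z; rewrite /= in_itv/= andbT => z0; rewrite mulr_ge0 ?K0// mulr_ge0 ?powR_ge0.
  - by rewrite mulr_ge0 ?(ltW C0).
have P10 z : 0 < z -> 0 <= P1 z.
  by move=> z0; rewrite !mulr_ge0 ?powR_ge0// invr_ge0 addr_ge0// ltW.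
have w0 z : 0 <= w z by rewrite mulr_ge0 ?powR_ge0.
have [j1 j1E] : exists j1, (\int[mu]_(z in Rp) (P1 z)%:E = j1%:E)%E.
  exists (fine (\int[mu]_(z in Rp) (P1 z)%:E)%E); rewrite fineK// ge0_fin_numE//.
  by apply: integral_ge0 => z; rewrite /= in_itv/= andbT => z0; rewrite lee_fin P10.
have [j2 j2E] : exists j2, (\int[mu]_(z in Rp) (w z * (z `^ c * beta_kernel c m z))%:E = j2%:E)%E.
  exists (fine (\int[mu]_(z in Rp) (w z * (z `^ c * beta_kernel c m z))%:E)%E).
  rewrite fineK// ge0_fin_numE//.
  by apply: integral_ge0 => z; rewrite /= in_itv/= andbT => z0; rewrite lee_fin mulr_ge0 ?K0.
exists j1, j2; split => //.
pose r t := (1 + t) / (p + t * q).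
(* [k] times [G] is what the kernel part becomes after the exchange, by [kernel_tail]. That formula
   excludes m = 1, but there the coefficient m - 1 of [j2] vanishes, and zero can be taken for [G],
   [g] and [k]. *)
have [G [g [k [iG gE kg GE]]]] : exists G : R -> R, exists g k : R,
    [/\ mu.-integrable Rp (EFin \o G), (\int[mu]_(t in Rp) (G t)%:E = g%:E)%E,
       k * g = (p - q) * (m - 1) * j2 &
       forall t, 0 < t -> phi t * (q `^ (1 - m) - r t `^ (m - 1)) = k * G t].
  have [m1|m1] := eqVneq m 1.
    exists (fun=> 0), 0, 0; split => //.
    - exact: integrable0.
    - by rewrite integral0.
    - by rewrite m1; ring.
    - by move=> t _; rewrite m1 subrr !powRr0 subrr; ring.
  pose G t := phi t * ((q `^ (1 - m) - r t `^ (m - 1)) / ((m - 1) * (p - q))).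
  have GE : (\int[mu]_(t in Rp) (G t)%:E = j2%:E)%E.
    rewrite -j2E kernel_swap//; apply: eq_integral => t /set_mem /=.
    by rewrite in_itv/= andbT => t0; rewrite kernel_tail// -EFinM.
  have m10 : m - 1 != 0 by rewrite subr_eq0.
  have pq0 : p - q != 0 by rewrite subr_eq0.
  exists G, j2, ((p - q) * (m - 1)); split => //.
    apply: (@ge0_integrable_Rp G j2) => //.
      apply: measurable_funM; first exact: mphi.
      apply: measurable_funM; last exact: measurable_cst.
      apply: measurable_funB; first exact: measurable_cst.
      apply: (eq_measurable_fun (fun t : R => (1 + t) `^ (m - 1) * (p + t * q) `^ (- (1) * (m - 1)))).
        move=> t /set_mem /=; rewrite in_itv/= andbT => t0.
        have pt0 : 0 <= p + t * q by rewrite addr_ge0 ?mulr_ge0// ltW.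
        by rewrite /r powRM ?invr_ge0 ?pt0 ?addr_ge0 ?(ltW t0)// -(powR_inv1 pt0) -powRrM.
      by apply: measurable_funM; [exact: m1D|exact: measurable_affine_powR].
    move=> t t0; apply: mulr_ge0; first by rewrite mulr_ge0 ?powR_ge0.
    rewrite -lee_fin /r -(kernel_tail p0 q0 pq m1 t0).
    by apply: integral_ge0 => z _; rewrite lee_fin; exact: w0.
  move=> t t0; rewrite /G.
  by move: (phi t) (q `^ (1 - m)) (r t `^ (m - 1)) => A B E; field; rewrite pq0.
have iP1 : mu.-integrable Rp (EFin \o P1) by exact: (ge0_integrable_Rp mP1 P10 j1E).
pose D t := t `^ (c - 1) * ((q + t * q) `^ (- m) - (p + t * q) `^ (- m)).
(* The two parts combine pointwise into a difference of beta integrands, because (p - q) - (p + t q)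
   = -q (1 + t). *)
have DE t : 0 < t -> (p - q) * P1 t + k * G t = q * D t.
  move=> t0; rewrite -GE// /P1 /D /phi.
  have t10 : 0 < 1 + t by rewrite addr_gt0.
  have pt0 : 0 < p + t * q by rewrite addr_gt0 ?mulr_gt0.
  have -> : q + t * q = q * (1 + t) by ring.
  rewrite powRM ?(ltW t10) ?(ltW q0)// /r powRM ?invr_ge0 ?(ltW t10) ?(ltW pt0)//.
  rewrite -(powR_inv1 (ltW pt0)) -powRrM.
  rewrite (_ : - 1 * (m - 1) = 1 + - m); last by ring.
  rewrite (gt0_powRD _ _ pt0) (gt0_powRD _ _ q0) !powRr1 ?(ltW q0) ?(ltW pt0)//.
  rewrite (gt0_powRD _ _ t10) powR_inv1 ?(ltW t10)// (powRN (1 + t)).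
  have := powR_gt0 m t10.
  move: (t `^ (c - 1)) ((p + t * q) `^ (- m)) (q `^ (- m)) ((1 + t) `^ m) => X Y U V V0.
  by field; rewrite !gt_eqF.
have intD : (\int[mu]_(t in Rp) (q * D t)%:E = ((p - q) * (j1 + (m - 1) * j2))%:E)%E.
  transitivity (\int[mu]_(t in Rp) (((p - q)%:E * (P1 t)%:E) + (k%:E * (G t)%:E)))%E.
    apply: eq_integral => t /set_mem /=; rewrite in_itv/= andbT => t0.
    by rewrite -!EFinM -EFinD DE.
  rewrite integralD; [|exact: measurable_itv|exact: integrableZl|exact: integrableZl].
  rewrite !integralZl; [|exact: measurable_itv|exact: iG|exact: measurable_itv|exact: iP1].
  by rewrite j1E gE -!EFinM -EFinD kg; congr EFin; ring.
have Gm := Gamma_pos_gt0 m0.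
have GmS : Gamma_pos (a + c) = m * Gamma_pos m.
  by rewrite -Gamma_posS//; congr Gamma_pos; rewrite /m; ring.
pose E l h t := t `^ (c - 1) * ((l + t * q) `^ (- m) - (h + t * q) `^ (- m)).
have iE l h v : 0 < l -> l < h -> (\int[mu]_(t in Rp) (E l h t)%:E = v%:E)%E ->
    mu.-integrable Rp (EFin \o E l h).
  move=> l0 lh; apply: ge0_integrable_Rp.
    apply: measurable_funM; first exact: mpow.
    by apply: measurable_funB; exact: measurable_affine_powR.
  move=> t t0; rewrite mulr_ge0 ?powR_ge0// subr_ge0.
  have lt0 : 0 < l + t * q by rewrite addr_gt0 ?mulr_gt0.
  have lht : l + t * q <= h + t * q by rewrite lerD2r ltW.
  rewrite !powRN lef_pV2 ?posrE ?powR_gt0 ?(lt_le_trans lt0)//.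
  by apply: ge0_ler_powR; rewrite ?nnegrE ?(ltW m0) ?(ltW lt0) ?(le_trans (ltW lt0)).
(* [beta_difference] takes the smaller base first, so the two orders of p and q are treated apart;
   for p < q the sign of [S] is reversed. *)
have [S [HS1 HS2]] : exists S,
  (p - q) * (j1 + (m - 1) * j2) = q * (m * (Gamma_pos a * Gamma_pos c / Gamma_pos (a + c)) * q `^ (- c) * S) /\
  (1 - a) * S = p `^ (1 - a) - q `^ (1 - a).
  have [pltq|qltp|/eqP] := ltgtP p q; last by rewrite (negbTE pq).
    have [S [HS1 HS2]] := beta_difference a0 c0 ac0 q0 p0 pltq.
    exists (- S); split; last by rewrite mulrN HS2 opprB.
    apply/EFin_inj; rewrite -intD.
    transitivity (\int[mu]_(t in Rp) ((- q)%:E * (E p q t)%:E))%E.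
      by apply: eq_integral => t _; rewrite -EFinM; congr EFin; rewrite /D /E; ring.
    rewrite integralZl; [|exact: measurable_itv|exact: (iE _ _ _ p0 pltq HS1)].
    rewrite /E HS1 -EFinM; congr EFin; rewrite /m.
    by move: (Gamma_pos a * Gamma_pos c / Gamma_pos (a + c)) (q `^ (- c)) => X U; ring.
  have [S [HS1 HS2]] := beta_difference a0 c0 ac0 q0 q0 qltp.
  exists S; split => //; apply/EFin_inj; rewrite -intD.
  transitivity (\int[mu]_(t in Rp) (q%:E * (E q p t)%:E))%E.
    by apply: eq_integral => t _; rewrite -EFinM; congr EFin.
  rewrite integralZl; [|exact: measurable_itv|exact: (iE _ _ _ q0 qltp HS1)].
  by rewrite /E HS1 -EFinM.
rewrite -[(a - 1) * (p - q) * _]mulrA HS1 GmS gt0_powRD// powRr1 ?(ltW q0)//.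
rewrite -[q `^ (1 - a) - _]opprB -HS2.
move: (Gamma_pos a) (Gamma_pos c) (Gamma_pos m) Gm (q `^ (- c)) => X Y V V0 U.
by field; rewrite !gt_eqF.
Qed.

End MeanKernel.

(** * Ratios of gamma variables *)

Section GammaPair.
Context {R : realType} d (T : measurableType d) (P : probability T R).
Local Notation mu := (@lebesgue_measure R).
Local Notation Rp := (`]0%R, +oo[%classic : set R).
Implicit Types (X Y : {RV P >-> R}) (a b : R).
#[local] Opaque powR Gamma_pos.

Lemma gamma_pdf_ge0 a b x : 0 < a -> 0 <= gamma_pdf a b x :> R.
Proof.
move=> a0; rewrite /gamma_pdf; case: ifPn => // x0.
by rewrite !mulr_ge0 ?powR_ge0 ?expR_ge0// invr_ge0 GammaE// ltW// Gamma_pos_gt0.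
Qed.

Lemma measurable_gamma_pdf a b : measurable_fun [set: R] (gamma_pdf a b : R -> R).
Proof.
rewrite /gamma_pdf; apply: measurable_fun_ifT.
- by apply: measurable_fun_ltr; [exact: measurable_cst|exact: measurable_id].
- apply: measurable_funM.
    by apply: measurable_funM; [exact: measurable_cst|exact: measurable_powR].
  apply: measurableT_comp => //; apply: measurableT_comp => //; exact: mulrl_measurable.
- exact: measurable_cst.
Qed.

Lemma integral_has_gamma_dist X a b (f : R -> \bar R) : 0 < a -> has_gamma_dist X a b ->
  measurable_fun [set: R] f -> (forall x, 0 <= f x)%E ->
  (\int[distribution P X]_x f x =
   \int[mu]_(x in Rp) (f x * (gamma_pdf a b x)%:E))%E.
Proof.
move=> a0 Xg mf f0.
(* Lebesgue measure lives on [measurableTypeR R]; the same map is packed with that codomain so that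
   its law and its density share one measurable space. *)
have mX : @measurable_fun _ _ T (measurableTypeR R) [set: T] X.
  by move=> mT B mB; exact: (measurable_funPT X mT B mB).
pose mixin := isMeasurableFun.Build _ _ _ _ _ mX.
pose X' : {mfun T >-> measurableTypeR R} := HB.pack (X : T -> measurableTypeR R) mixin.
transitivity (\int[pushforward P X']_x f x)%E.
  rewrite (ge0_integral_pushforward mX)//.
  by rewrite (ge0_integral_pushforward (measurable_funPT X)).
rewrite (@ge0_integral_density _ _ _ mu (pushforward P X') (gamma_pdf a b))//.
- rewrite [RHS]integral_mkcond; apply: eq_integral => x _; rewrite patchE.
  case: ifPn => //; rewrite notin_setE /= in_itv/= andbT => /negP x0.
  by rewrite /gamma_pdf (negbTE x0) mule0.
- exact: measurable_gamma_pdf.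
- by move=> x; exact: gamma_pdf_ge0.
Qed.

Lemma integral_gamma_pair X Y a1 a2 b1 b2 (f : R * R -> \bar R) :
  0 < a1 -> 0 < a2 -> has_gamma_dist X a1 b1 -> has_gamma_dist Y a2 b2 ->
  independent_RV X Y -> measurable_fun [set: R * R] f -> (forall z, 0 <= f z)%E ->
  (\int[P]_w f (X w, Y w) = \int[mu]_(x in Rp) \int[mu]_(y in Rp)
     (f (x, y) * (gamma_pdf a1 b1 x * gamma_pdf a2 b2 y)%:E))%E.
Proof.
move=> a10 a20 X1 Y2 XY mf f0.
have mXY : measurable_fun [set: T] (fun w => (X w, Y w)).
  by apply/measurable_fun_pairP; split; exact: measurable_funPT.
transitivity (\int[pushforward P (fun w => (X w, Y w))]_z f z)%E.
  by rewrite (ge0_integral_pushforward mXY).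
pose mixin := isMeasurableFun.Build _ _ _ _ _ mXY.
pose pack : {mfun _ >-> _} := HB.pack (fun w => (X w, Y w)) mixin.
(* By independence the joint law agrees with the product of the marginals on rectangles, which
   determines the product measure. *)
transitivity (\int[(distribution P X \x distribution P Y)%E]_z f z)%E.
  apply: eq_measure_integral => A mA _; apply/esym.
  apply: (@product_measure_unique _ _ _ _ _ (distribution P X) (distribution P Y) (pushforward P pack)) => //.
rewrite fubini_tonelli1//.
rewrite (integral_has_gamma_dist a10 X1); last 2 first.
- exact: measurable_fun_fubini_tonelli_F.
- by move=> x; apply: integral_ge0.
apply: eq_integral => x _.
rewrite /fubini_F (integral_has_gamma_dist a20 Y2)//; last first.
  by apply: measurableT_comp mf _; exact: measurable_pair1.
rewrite muleC -ge0_integralZl//.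
- by apply: eq_integral => y _; rewrite EFinM muleCA.
- apply: emeasurable_funM.
    by apply: measurable_funTS; apply: measurableT_comp mf _; exact: measurable_pair1.
  by apply/measurable_EFinP/measurable_funTS; exact: measurable_gamma_pdf.
- by move=> y _; rewrite mule_ge0// lee_fin gamma_pdf_ge0.
- by rewrite lee_fin gamma_pdf_ge0.
Qed.

(** Functions homogeneous of degree -j on the open quadrant: j = 1 for the terms of the estimator, j
    = 0 for the pivot. The complement of the quadrant is null for gamma pairs and gets the value
    0. *)
Definition ratio_fun (j rho : R) (k : R -> R) (x y : R) : R :=
  if (0 < x) && (0 < y) then x `^ (- j) * k (rho * (y / x)) else 0.

Lemma measurable_ratio_fun j rho k : 0 < rho -> measurable_fun Rp k ->
  measurable_fun [set: R * R] (fun z => ratio_fun j rho k z.1 z.2).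
Proof.
move=> rho0 mk.
have mQ : measurable (Rp `*` Rp) by apply: measurableX.
pose g (z : R * R) := z.1 `^ (- j) * k (rho * (z.2 / z.1)).
have -> : (fun z : R * R => ratio_fun j rho k z.1 z.2) = g \_ (Rp `*` Rp).
  apply/funext => z; rewrite /ratio_fun patchE; case: ifPn => [/andP[x0 y0]|xy].
    by rewrite mem_set//=; rewrite !in_itv/= !andbT.
  rewrite memNset// /= !in_itv/= !andbT => -[x0 y0].
  by rewrite x0 y0 in xy.
apply/(measurable_restrictT _ _).1 => //.
apply: measurable_funM.
  by apply: measurable_funTS; apply: (measurableT_comp (measurable_powR (- j))).
apply: (@measurable_comp _ _ _ _ _ _ Rp) => //.
- move=> _ [z [/= z1 z2] <-]; move: z1 z2; rewrite /= !in_itv/= !andbT => z1 z2.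
  by rewrite mulr_gt0// divr_gt0.
- apply: (eq_measurable_fun (fun z : R * R => rho * (z.2 * z.1 `^ (-1)))).
    move=> z /set_mem [/=]; rewrite !in_itv/= !andbT => z1 z2.
    by rewrite powR_inv1// ltW.
  apply: measurable_funTS; apply: measurable_funM; first exact: measurable_cst.
  apply: measurable_funM; first exact: measurable_snd.
  exact: (measurableT_comp (measurable_powR (- 1))).
Qed.

(** For fixed x the substitution y = (x / rho) z makes the ratio the new variable; after the
    exchange x occurs only in a Gamma integral with shape a1 + a2 - j and rate b1 + z b2 / rho. *)
Lemma integral_ratio_fun X Y a1 a2 b1 b2 j rho (k : R -> R) :
  0 < a1 -> 0 < a2 -> 0 < b1 -> 0 < b2 -> 0 < rho -> 0 < a1 + a2 - j ->
  has_gamma_dist X a1 b1 -> has_gamma_dist Y a2 b2 -> independent_RV X Y ->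
  measurable_fun Rp k -> (forall z, 0 < z -> 0 <= k z) ->
  (\int[P]_w (ratio_fun j rho k (X w) (Y w))%:E =
   (b1 `^ a1 * b2 `^ a2 * Gamma_pos (a1 + a2 - j) / (Gamma_pos a1 * Gamma_pos a2) * rho `^ (- a2))%:E *
   \int[mu]_(z in Rp) (k z * (z `^ (a2 - 1) * (b1 + z * (b2 / rho)) `^ (- (a1 + a2 - j))))%:E)%E.
Proof.
move=> a10 a20 b10 b20 rho0 s0 X1 Y2 XY mk k0.
have G1 := Gamma_pos_gt0 a10; have G2 := Gamma_pos_gt0 a20.
pose c := b1 `^ a1 / Gamma_pos a1 * (b2 `^ a2 / Gamma_pos a2) * rho `^ (- a2).
have c0 : 0 <= c by rewrite !mulr_ge0 ?powR_ge0// invr_ge0 ltW.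
have rf0 x y : 0 <= ratio_fun j rho k x y.
  rewrite /ratio_fun; case: ifPn => // /andP[x0 y0].
  by rewrite mulr_ge0 ?powR_ge0// k0// mulr_gt0// divr_gt0.
have mrf := measurable_ratio_fun j rho0 mk.
have mrx x : measurable_fun [set: R] (ratio_fun j rho k x).
  exact: (measurableT_comp mrf (measurable_pair1 x)).
rewrite (@integral_gamma_pair X Y a1 a2 b1 b2 (fun z => (ratio_fun j rho k z.1 z.2)%:E))//; last 2 first.
- exact/measurable_EFinP.
- by move=> z; rewrite lee_fin.
transitivity (\int[mu]_(x in Rp) \int[mu]_(z in Rp)
  ((c * (k z * z `^ (a2 - 1))) * (x `^ (a1 + a2 - j - 1) * expR (- ((b1 + z * (b2 / rho)) * x))))%:E)%E.
  apply: eq_integral => x /set_mem /=; rewrite in_itv/= andbT => x0.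
  have xr0 : 0 < x / rho by rewrite divr_gt0.
  rewrite (ge0_integral_scale xr0); last 2 first.
  - apply: emeasurable_funM.
      by apply/measurable_EFinP; apply: measurable_funTS; exact: mrx.
    apply/measurable_EFinP/measurable_funTS; apply: measurable_funM; first exact: measurable_cst.
    exact: measurable_gamma_pdf.
  - by move=> y _; rewrite mule_ge0 ?lee_fin ?mulr_ge0 ?gamma_pdf_ge0.
  rewrite -ge0_integralZl; last 4 first.
  - exact: measurable_itv.
  - apply: emeasurable_funM.
      apply/measurable_EFinP; apply: measurable_funTS; apply: (measurableT_comp (mrx x)).
      exact: mulrl_measurable.
    apply/measurable_EFinP/measurable_funTS; apply: measurable_funM; first exact: measurable_cst.
    by apply: (measurableT_comp (measurable_gamma_pdf _ _)); exact: mulrl_measurable.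
  - by move=> y _; rewrite mule_ge0 ?lee_fin ?mulr_ge0 ?gamma_pdf_ge0.
  - by rewrite lee_fin ltW.
  apply: eq_integral => z /set_mem /=; rewrite in_itv/= andbT => z0.
  have xz0 : 0 < x / rho * z by rewrite mulr_gt0.
  rewrite -!EFinM; congr EFin; rewrite /ratio_fun /gamma_pdf x0 xz0 /= !GammaE//.
  have -> : rho * (x / rho * z / x) = z by field; rewrite !gt_eqF.
  have -> : expR (- ((b1 + z * (b2 / rho)) * x)) = expR (- (b1 * x)) * expR (- (b2 * (x / rho * z))).
    by rewrite -expRD; congr expR; field; rewrite gt_eqF.
  rewrite powRM ?(ltW xr0) ?(ltW z0)// powRM ?invr_ge0 ?(ltW x0) ?(ltW rho0)//.
  rewrite -(powR_inv1 (ltW rho0)) -powRrM.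
  rewrite /c (_ : - a2 = -1 * (a2 - 1) + -1); last by ring.
  rewrite (_ : a1 + a2 - j - 1 = - j + (a1 - 1) + (a2 - 1) + 1); last by ring.
  rewrite !gt0_powRD// (powRr1 (ltW x0)).
  move: (expR (- (b1 * x))) (Gamma_pos a1)^-1 (Gamma_pos a2)^-1 (k z) => E1 I1 I2 kz.
  by ring.
rewrite tonelli_on; last 4 first.
- exact: measurable_itv.
- exact: measurable_itv.
- apply/measurable_EFinP; apply: measurable_funM.
    apply: (@measurable_comp _ _ _ _ _ _ Rp (fun z => c * (k z * z `^ (a2 - 1))) _ snd).
    + exact: measurable_itv.
    + by move=> _ [z [_ z2] <-].
    + apply: measurable_funM; first exact: measurable_cst.
      apply: measurable_funM => //; apply: measurable_funTS; exact: measurable_powR.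
    + by apply: measurable_funTS; exact: measurable_snd.
  apply: measurable_funTS; apply: measurable_funM.
    exact: (measurableT_comp (measurable_powR _)).
  apply: measurableT_comp => //; apply: measurableT_comp => //.
  apply: measurable_funM => //; apply: measurable_funD => //.
  by apply: measurable_funM.
- move=> x z; rewrite /= !in_itv/= !andbT => x0 z0.
  rewrite lee_fin; apply: mulr_ge0; last by rewrite mulr_ge0 ?powR_ge0 ?expR_ge0.
  by apply: (mulr_ge0 c0); rewrite mulr_ge0 ?powR_ge0 ?k0.
have -> : b1 `^ a1 * b2 `^ a2 * Gamma_pos (a1 + a2 - j) / (Gamma_pos a1 * Gamma_pos a2) * rho `^ (- a2) = c * Gamma_pos (a1 + a2 - j).
  rewrite /c invfM; move: (Gamma_pos (a1 + a2 - j)) (Gamma_pos a1)^-1 (Gamma_pos a2)^-1 => *; ring.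
rewrite -ge0_RintegralZl; last 4 first.
- exact: measurable_itv.
- apply: measurable_funM => //; apply: measurable_funM; last exact: measurable_affine_powR.
  by apply: measurable_funTS; exact: measurable_powR.
- by move=> z; rewrite /= in_itv/= andbT => z0; rewrite !mulr_ge0 ?powR_ge0 ?k0.
- by apply: (mulr_ge0 c0); exact/ltW/Gamma_pos_gt0.
apply: eq_integral => z /set_mem /=; rewrite in_itv/= andbT => z0.
have r0 : 0 < b1 + z * (b2 / rho) by rewrite addr_gt0// mulr_gt0// divr_gt0.
rewrite ge0_RintegralZl; last 4 first.
- exact: measurable_itv.
- apply: measurable_funTS; apply: measurable_funM; first exact: measurable_powR.
  by apply: measurableT_comp => //; apply: measurableT_comp => //; exact: mulrl_measurable.
- by move=> x _; rewrite mulr_ge0 ?powR_ge0 ?expR_ge0.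
- by apply: (mulr_ge0 c0); rewrite mulr_ge0 ?powR_ge0 ?k0.
rewrite integral_gamma_rate// -EFinM; congr EFin.
by move: (Gamma_pos (a1 + a2 - j)) (k z) => G kz; ring.
Qed.

End GammaPair.

(** * The estimator *)

Section Estimator.
Context {R : realType}.
Local Notation Rp := (`]0%R, +oo[%classic : set R).
Implicit Types a c e m nu x y z : R.
#[local] Opaque powR Gamma_pos beta_kernel.

(** On the right the Gamma function occurs at positive arguments only, and the pole of Gamma(a - 1 -
    nu) has become the zero of a - 1 - nu. That side is continuous in a across a = 1 and a = 1 +
    nu. *)
Lemma pochhammer_shift a nu : 0 < a -> a != 1 -> nu < a ->
  (a - 1) / pochhammer (a - 1) (- nu) = Gamma_pos a * (a - 1 - nu) / Gamma_pos (a - nu).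
Proof.
move=> a0 a1 nua; rewrite /pochhammer.
have a10 : a - 1 != 0 by rewrite subr_eq0.
have h1 : - 1 < a - 1 by lra.
have h2 : - 1 < a - 1 - nu by lra.
have := Gamma_inv h1; rewrite subrK => E1.
have := Gamma_inv h2; rewrite [a - 1 - nu + 1](_ : _ = a - nu); last by ring.
move=> E2; rewrite invf_div -[Gamma (a - 1)]invrK E1 -mulrA E2.
have := Gamma_pos_gt0 a0; move: (Gamma_pos a) (Gamma_pos (a - nu))^-1 => G I G0.
by field; rewrite a10 gt_eqF.
Qed.

(** The value of 2F1(1, 1 + c - m; c; -z), indexed by m instead of b because the two terms of the
    estimator share m. *)
Definition hyp_value c m z : R :=
  (1 + (m - 1) * (z * (1 + z) `^ (m - 1) * beta_kernel c m z)) / (1 + z).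

Lemma hyp2F1_value b c m z : 0 < c -> 0 < z -> m = 1 + c - b ->
  hyp2F1 1 b c (- z) = hyp_value c m z.
Proof.
move=> c0 z0 ->; rewrite hyp2F1_beta_kernel// /hyp_value.
by rewrite (_ : 1 + c - b - 1 = c - b)//; ring.
Qed.

(** The estimator with its prefactor a - 1 distributed over the difference and absorbed by
    [pochhammer_shift], which removes the singularities. The shape alpha1 is the last argument, the
    limit being taken in it. *)
Definition T_value a2 nu x y a : R :=
  let z := a2 * y / x / a in
  (a * x)^-1 * ((a - 1) * hyp_value a2 (a + (a2 - 1)) z -
    Gamma_pos a * Gamma_pos a2 * (a - 1 - nu) / (Gamma_pos (a - nu) * Gamma_pos (a2 + nu)) *
    (z `^ nu * hyp_value (a2 + nu) (a + (a2 - 1)) z)).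

Lemma T_formula_value a a2 nu x y : 0 < a -> 0 < a2 -> - a2 < nu < a -> a != 1 ->
  0 < x -> 0 < y -> T_formula a a2 nu x y = T_value a2 nu x y a.
Proof.
move=> a0 a20 /andP[nu1 nu2] a1 x0 y0.
have c0 : 0 < a2 + nu by lra.
have z0 : 0 < a2 * y / x / a by rewrite !divr_gt0// mulr_gt0.
rewrite /T_formula /T_value (_ : a2 * y / (a * x) = a2 * y / x / a); last first.
  by field; rewrite !gt_eqF.
move: (a2 * y / x / a) z0 => z z0.
rewrite !(@hyp2F1_value _ _ (a + (a2 - 1)))//; [|ring|ring].
rewrite /pochhammer (GammaE a20) (GammaE c0) -/(pochhammer (a - 1) (- nu)).
have G1 := Gamma_pos_gt0 a20; have G2 := Gamma_pos_gt0 c0.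
have a10 : a - 1 != 0 by rewrite subr_eq0.
rewrite [_ / (_ * (_ / _))](_ : _ = (pochhammer (a - 1) (- nu))^-1 * (z `^ nu * Gamma_pos a2 / Gamma_pos (a2 + nu))); last first.
  move: (pochhammer _ _) => u; rewrite invfM invf_div; move: u^-1 (z `^ nu) (Gamma_pos a2) (Gamma_pos (a2 + nu))^-1 => *; ring.
have -> : (pochhammer (a - 1) (- nu))^-1 =
    (a - 1)^-1 * (Gamma_pos a * (a - 1 - nu) / Gamma_pos (a - nu)).
  by rewrite -pochhammer_shift// mulKf.
rewrite [(Gamma_pos (a - nu) * _)^-1]invfM.
move: (hyp_value _ _ _) (hyp_value _ _ _) (z `^ nu) (Gamma_pos a) (Gamma_pos a2) (Gamma_pos (a - nu))^-1 (Gamma_pos (a2 + nu))^-1 => H1 H2 Z A B C D.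
by field; rewrite a10 !gt_eqF.
Qed.

Lemma cvg_hyp_value c e k a : 0 < c -> 0 < k -> 0 < a ->
  hyp_value c (x + e) (k / x) @[x --> a] --> hyp_value c (a + e) (k / a).
Proof.
move=> c0 k0 a0; have a0n : a != 0 by rewrite gt_eqF.
have cz : k / x @[x --> a] --> k / a.
  by apply: cvgM; [exact: cvg_cst|apply: cvgV => //; exact: cvg_id].
have cm : x + e - 1 @[x --> a] --> a + e - 1.
  by apply: cvgB; [apply: cvgD; [exact: cvg_id|exact: cvg_cst]|exact: cvg_cst].
have c1z : 1 + k / x @[x --> a] --> 1 + k / a by apply: cvgD => //; exact: cvg_cst.
have z0 : 0 < 1 + k / a by rewrite addr_gt0// divr_gt0.
apply: cvgM; last by apply: cvgV => //; rewrite gt_eqF.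
apply: cvgD; first exact: cvg_cst.
apply: cvgM => //; apply: cvgM; last exact: continuous_beta_kernel.
apply: cvgM => //; exact: cvg_powR2.
Qed.

(** On a punctured neighbourhood of a1 the formula agrees with [T_value], which is continuous at a1,
    so the limit that fills a removable singularity is the value of [T_value] there. *)
Lemma T_statE a1 a2 nu x y : 0 < a1 -> 0 < a2 -> - a2 < nu < a1 -> nu != 0 ->
  0 < x -> 0 < y -> T_stat a1 a2 nu x y = T_value a2 nu x y a1.
Proof.
move=> a10 a20 nu12 nu0 x0 y0; have /andP[nu1 nu2] := nu12.
have c0 : 0 < a2 + nu by lra.
rewrite /T_stat; case: ifPn; last first.
  by rewrite negb_or => /andP[a11 _]; exact: T_formula_value.
move=> _; have k0 : 0 < a2 * y / x by rewrite divr_gt0// mulr_gt0.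
have ca : a @[a --> a1] --> a1 by exact: cvg_id.
have cG b : 0 < a1 - b -> Gamma_pos (a - b) @[a --> a1] --> Gamma_pos (a1 - b).
  move=> b0; apply: (@continuous_cvg _ _ _ _ _ _ (@Gamma_pos R)).
    exact: continuous_Gamma_pos.
  by apply: cvgB => //; exact: cvg_cst.
have cS : T_value a2 nu x y a @[a --> a1] --> T_value a2 nu x y a1.
  rewrite /T_value; apply: cvgM.
    apply: cvgV; first by rewrite mulf_neq0 ?gt_eqF.
    by apply: cvgM => //; exact: cvg_cst.
  apply: cvgB; apply: cvgM.
  - by apply: cvgB => //; exact: cvg_cst.
  - exact: cvg_hyp_value.
  - apply: cvgM; last first.
      apply: cvgV; first by rewrite mulf_neq0// gt_eqF// Gamma_pos_gt0// subr_gt0.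
      by apply: cvgM; [apply: cG; rewrite subr_gt0|exact: cvg_cst].
    apply: cvgM; last by apply: cvgB; [apply: cvgB => //|]; exact: cvg_cst.
    apply: cvgM; last exact: cvg_cst.
    by have := cG 0; rewrite subr0 => /(_ a10); under eq_fun do rewrite subr0.
  - apply: cvgM; last exact: cvg_hyp_value.
    apply: cvg_powR; first by rewrite divr_gt0.
    by apply: cvgM; [exact: cvg_cst|apply: cvgV; rewrite ?gt_eqF].
apply/cvg_lim => //.
have : T_value a2 nu x y a @[a --> a1^'] --> T_value a2 nu x y a1.
  exact: cvg_within_filter cS.
apply: cvg_trans; apply: near_eq_cvg.
have n1 : \forall a \near a1^', 0 < a by apply: nbhs_dnbhs; exact: lt_nbhsr.
have n2 : \forall a \near a1^', nu < a by apply: nbhs_dnbhs; exact: lt_nbhsr.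
(* If a1 = 1 the punctured filter excludes 1; otherwise 1 stays at a positive distance. *)
have n3 : \forall a \near a1^', a != 1.
  have [->|a11] := eqVneq a1 1; first exact: nbhs_dnbhs_neq.
  apply: nbhs_dnbhs; move: a11; rewrite neq_lt => /orP[a11|a11].
    by near do rewrite lt_eqF//; exact: lt_nbhsl.
  by near do rewrite gt_eqF//; exact: lt_nbhsr.
by near=> a; apply/esym/T_formula_value => //; [near: a|apply/andP; split => //; near: a|near: a].
Unshelve. all: by end_near. Qed.

End Estimator.

(** * Expectation of the estimator *)

Section Expectation.
Context {R : realType} d (T : measurableType d) (P : probability T R).
Local Notation mu := (@lebesgue_measure R).
Local Notation Rp := (`]0%R, +oo[%classic : set R).
Implicit Types (X Y : {RV P >-> R}) (a b : R).
#[local] Opaque powR Gamma_pos beta_kernel.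

Lemma measurable_ratio_RV X Y j rho (k : R -> R) : 0 < rho -> measurable_fun Rp k ->
  measurable_fun [set: T] (fun w => ratio_fun j rho k (X w) (Y w)).
Proof.
move=> rho0 mk.
have mXY : measurable_fun [set: T] (fun w => (X w, Y w)).
  by apply/measurable_fun_pairP; split; exact: measurable_funPT.
exact: (measurableT_comp (measurable_ratio_fun j rho0 mk) mXY).
Qed.

Lemma integrable_ratio_fun X Y j rho (k : R -> R) v : 0 < rho -> measurable_fun Rp k ->
  (forall z, 0 < z -> 0 <= k z) ->
  (\int[P]_w (ratio_fun j rho k (X w) (Y w))%:E = v%:E)%E ->
  P.-integrable [set: T] (EFin \o (fun w => ratio_fun j rho k (X w) (Y w))).
Proof.
move=> rho0 mk k0 intv; apply/integrableP; split.
  by apply/measurable_EFinP; exact: measurable_ratio_RV.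
apply: (@le_lt_trans _ _ v%:E); last exact: ltry.
rewrite -intv le_eqVlt; apply/orP; left; apply/eqP.
apply: eq_integral => w _ /=; rewrite ger0_norm// /ratio_fun; case: ifPn => // /andP[x0 y0].
by rewrite mulr_ge0 ?powR_ge0 ?k0// mulr_gt0// divr_gt0.
Qed.

(** Serves both terms of the estimator, with e = 0 and e = nu; the part p^a1 q^(2 - a1) of the
    result is free of e, hence cancels between them. The mean is given up to the factor a1 - 1 - e,
    which may be 0; the coefficient of the term in the estimator carries the same factor. *)
Lemma mean_ratio X Y a1 a2 k1 k2 e : 0 < a1 -> 0 < a2 -> 0 < k1 -> 0 < k2 -> k1 != k2 ->
  1 < a1 + a2 -> - a2 < e < a1 ->
  has_gamma_dist X a1 (a1 / k1) -> has_gamma_dist Y a2 (a2 / k2) -> independent_RV X Y ->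
  let U w := ratio_fun 1 (a2 / a1)
    (fun z => z `^ e * hyp_value (a2 + e) (a1 + (a2 - 1)) z) (X w) (Y w) in
  let p := a1 / k1 in let q := a1 / k2 in
  P.-integrable [set: T] (EFin \o U) /\ exists J,
   (\int[P]_w (U w)%:E = J%:E)%E /\
   (a1 - 1 - e) * J = Gamma_pos (a1 - e) * Gamma_pos (a2 + e) / (Gamma_pos a1 * Gamma_pos a2)
     * ((p `^ a1 * q `^ (2 - a1) - p * q * (k2 / k1) `^ e) / (p - q)).
Proof.
move=> a10 a20 k10 k20 k12 a12 /andP[e1 e2] Xg Yg XY U p q.
have p0 : 0 < p by rewrite divr_gt0.
have q0 : 0 < q by rewrite divr_gt0.
have pq : p != q.
  apply: contra k12 => /eqP pq; apply/eqP.
  by rewrite -[k1]invrK -[k2]invrK; congr (_^-1); apply: (mulfI (lt0r_neq0 a10)).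
have rho0 : 0 < a2 / a1 by rewrite divr_gt0.
have b20 : 0 < a2 / k2 by rewrite divr_gt0.
set m := a1 + (a2 - 1) in U *.
have m0 : 0 < m by rewrite /m; lra.
have mE : a1 + a2 - 1 = m by rewrite /m addrA.
have ace : a1 - e + (a2 + e) - 1 = m by rewrite /m; ring.
have a0 : 0 < a1 - e by lra.
have c0 : 0 < a2 + e by lra.
have ac0 : 0 < a1 - e + (a2 + e) - 1 by rewrite ace.
have /= [j1 [j2 []]] := mean_kernel a0 c0 ac0 p0 q0 pq.
rewrite ace => H1 H2 H3.
(* [Q1] and m - 1 times [Q2] are the two summands of z^e times the hypergeometric value; [Q1] and
   [Q2] are nonnegative. *)
pose Q1 (z : R) := z `^ e * (1 + z)^-1.
pose Q2 z := z `^ (e + 1) * (1 + z) `^ (m - 2) * beta_kernel (a2 + e) m z.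
have Q10 z : 0 < z -> 0 <= Q1 z.
  by move=> z0; rewrite mulr_ge0 ?powR_ge0// invr_ge0 addr_ge0// ltW.
have Q20 z : 0 < z -> 0 <= Q2 z.
  move=> z0; rewrite !mulr_ge0 ?powR_ge0//.
  by apply: Rintegral_ge0 => // s _; rewrite mulr_ge0 ?powR_ge0.
have mQ1 : measurable_fun Rp Q1.
  apply: (eq_measurable_fun (fun z : R => z `^ e * (1 + z * 1) `^ (- 1))).
    move=> z /set_mem /=; rewrite in_itv/= andbT => z0.
    by rewrite mulr1 powR_inv1// addr_ge0// ltW.
  apply: measurable_funM; last exact: measurable_affine_powR.
  by apply: measurable_funTS; exact: measurable_powR.
have mQ2 : measurable_fun Rp Q2.
  apply: measurable_funM; last exact: measurable_beta_kernel (ltW m0).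
  apply: measurable_funM.
    by apply: measurable_funTS; exact: measurable_powR.
  rewrite (_ : (fun z => _) = fun z => (1 + z * 1) `^ (m - 2)); first exact: measurable_affine_powR.
  by apply/funext => z; rewrite mulr1.
pose N := p `^ a1 * (a2 / k2) `^ a2 * Gamma_pos m / (Gamma_pos a1 * Gamma_pos a2) * (a2 / a1) `^ (- a2).
have qE : a2 / k2 / (a2 / a1) = q by rewrite /q; field; rewrite !gt_eqF.
have s0 : 0 < a1 + a2 - 1 by rewrite mE.
have I1 : (\int[P]_w (ratio_fun 1 (a2 / a1) Q1 (X w) (Y w))%:E = (N * j1)%:E)%E.
  rewrite (integral_ratio_fun a10 a20 p0 b20 rho0 s0 Xg Yg XY mQ1 Q10) mE qE [RHS]EFinM; congr (_ * _)%E.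
  rewrite -H1; apply: eq_integral => z /set_mem /=; rewrite in_itv/= andbT => z0.
  rewrite (_ : a2 + e - 1 = e + (a2 - 1)); last by ring.
  rewrite (gt0_powRD e (a2 - 1) z0) /Q1; congr EFin.
  by move: (z `^ e) (z `^ (a2 - 1)) ((p + z * q) `^ (- m)) => A B C; ring.
have I2 : (\int[P]_w (ratio_fun 1 (a2 / a1) Q2 (X w) (Y w))%:E = (N * j2)%:E)%E.
  rewrite (integral_ratio_fun a10 a20 p0 b20 rho0 s0 Xg Yg XY mQ2 Q20) mE qE [RHS]EFinM; congr (_ * _)%E.
  rewrite -H2; apply: eq_integral => z /set_mem /=; rewrite in_itv/= andbT => z0.
  rewrite (_ : a2 + e = (e + 1) + (a2 - 1)); last by ring.
  rewrite (gt0_powRD (e + 1) (a2 - 1) z0) /Q2 (_ : a2 + e = (e + 1) + (a2 - 1)); last by ring.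
  congr EFin; move: (z `^ (e + 1)) (z `^ (a2 - 1)) ((p + z * q) `^ (- m)) => A B C.
  by move: ((1 + z) `^ (m - 2)) (beta_kernel _ _ _) => D E; ring.
have iU1 := integrable_ratio_fun rho0 mQ1 Q10 I1.
have iU2 := integrable_ratio_fun rho0 mQ2 Q20 I2.
have UE : EFin \o U = (fun w => (ratio_fun 1 (a2 / a1) Q1 (X w) (Y w))%:E +
    (m - 1)%:E * (ratio_fun 1 (a2 / a1) Q2 (X w) (Y w))%:E)%E.
  apply/funext => w /=; rewrite -EFinM -EFinD; congr EFin.
  rewrite /U /ratio_fun; case: ifPn => [/andP[x0 y0]|_]; last by rewrite mulr0 addr0.
  have z0 : 0 < a2 / a1 * (Y w / X w) by rewrite mulr_gt0// divr_gt0.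
  move: (a2 / a1 * (Y w / X w)) z0 => z z0.
  have z10 : 0 < 1 + z by rewrite addr_gt0.
  rewrite /hyp_value /Q1 /Q2 (_ : m - 1 = (m - 2) + 1); last by ring.
  rewrite !gt0_powRD// (powRr1 (ltW z0)) (powRr1 (ltW z10)).
  move: (X w `^ (- 1)) (z `^ e) ((1 + z) `^ (m - 2)) (beta_kernel _ _ _) => A B C D.
  by field; rewrite gt_eqF.
have iU2' : P.-integrable [set: T] (fun w => (m - 1)%:E * (ratio_fun 1 (a2 / a1) Q2 (X w) (Y w))%:E)%E.
  by apply: integrableZl => //; exact: measurableT.
split.
  by rewrite UE; apply: integrableD => //; exact: measurableT.
exists (N * (j1 + (m - 1) * j2)); split.
  transitivity (\int[P]_w ((ratio_fun 1 (a2 / a1) Q1 (X w) (Y w))%:E +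
    (m - 1)%:E * (ratio_fun 1 (a2 / a1) Q2 (X w) (Y w))%:E))%E.
    by apply: eq_integral => w _; rewrite -[LHS]/((EFin \o U) w) UE.
  rewrite integralD; [|exact: measurableT|exact: iU1|exact: iU2'].
  rewrite integralZl; [|exact: measurableT|exact: iU2].
  by rewrite I1 I2 -EFinM -EFinD; congr EFin; ring.
have NE : N = p `^ a1 * q `^ a2 * Gamma_pos m / (Gamma_pos a1 * Gamma_pos a2).
  rewrite /N (_ : a2 / k2 = q * (a2 / a1)); last by rewrite /q; field; rewrite !gt_eqF.
  rewrite (powRM _ (ltW q0) (ltW rho0)) powRN.
  have := powR_gt0 a2 rho0; move: ((a2 / a1) `^ a2) (q `^ a2) (p `^ a1) => A B C A0.
  have := Gamma_pos_gt0 a10; have := Gamma_pos_gt0 a20.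
  move: (Gamma_pos a1) (Gamma_pos a2) (Gamma_pos m) => G1 G2 G3 G10 G20.
  by field; rewrite !gt_eqF.
have pq0 : p - q != 0 by rewrite subr_eq0.
(* With a = a1 - e and c = a2 + e the exponents add up so that e drops out here; in the next product
   it survives only in (p / q)^e = (k2 / k1)^e. *)
have S1 : p `^ a1 * q `^ a2 * q `^ (1 - (a2 + e)) * q `^ (1 - (a1 - e)) = p `^ a1 * q `^ (2 - a1).
  by rewrite -!mulrA -!gt0_powRD//; congr (_ * _ `^ _); ring.
have S2 : p `^ a1 * q `^ a2 * q `^ (1 - (a2 + e)) * p `^ (1 - (a1 - e)) = p * q * (k2 / k1) `^ e.
  have -> : k2 / k1 = p / q by rewrite /p /q; field; rewrite !gt_eqF.
  rewrite powRM ?invr_ge0 ?(ltW p0) ?(ltW q0)// -(powR_inv1 (ltW q0)) -powRrM.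
  rewrite -[_ * q `^ (1 - _)]mulrA -gt0_powRD// mulrAC -gt0_powRD//.
  rewrite (_ : a1 + (1 - (a1 - e)) = 1 + e); last by ring.
  rewrite (_ : a2 + (1 - (a2 + e)) = 1 + - 1 * e); last by ring.
  rewrite !gt0_powRD// !powRr1 ?(ltW p0) ?(ltW q0)//.
  by move: (p `^ e) (q `^ (- 1 * e)) => A B; ring.
have Gm := Gamma_pos_gt0 m0; have G1 := Gamma_pos_gt0 a10; have G2 := Gamma_pos_gt0 a20.
rewrite -S1 -S2 NE.
have {}H3 : (a1 - 1 - e) * (j1 + (m - 1) * j2) = Gamma_pos (a1 - e) * Gamma_pos (a2 + e) *
    q `^ (1 - (a2 + e)) * (q `^ (1 - (a1 - e)) - p `^ (1 - (a1 - e))) / (p - q) / Gamma_pos m.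
  by rewrite -H3; field; rewrite pq0 gt_eqF.
rewrite mulrCA H3.
move: (Gamma_pos (a1 - e)) (Gamma_pos (a2 + e)) (Gamma_pos a1) (Gamma_pos a2) (Gamma_pos m) G1 G2 Gm => A B C D E C0 D0 E0.
move: (p `^ a1) (q `^ a2) (q `^ (1 - (a2 + e))) (q `^ (1 - (a1 - e))) (p `^ (1 - (a1 - e))) => F G H I J.
by field; rewrite pq0 !gt_eqF.
Qed.

Lemma gamma_dist_le0 X a b : has_gamma_dist X a b -> P (X @^-1` `]-oo, 0]) = 0.
Proof.
move=> Xg; have := Xg `]-oo, 0]%classic (measurable_itv _); rewrite /distribution /pushforward => ->.
apply: integral0_eq => x; rewrite /= in_itv/= => x0.
by rewrite /gamma_pdf ltNge x0.
Qed.

Lemma measurable_pos_pair X Y : measurable [set w | 0 < X w /\ 0 < Y w].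
Proof.
have m0 (Z : {RV P >-> R}) : measurable [set w | 0 < Z w].
  have := measurable_funPT Z measurableT `]0, +oo[%classic (measurable_itv _).
  rewrite setTI; congr measurable; apply/seteqP; split => w /=; rewrite in_itv/= andbT//.
by apply: measurableI; exact: m0.
Qed.

Lemma gamma_pair_pos X Y a1 a2 b1 b2 : has_gamma_dist X a1 b1 -> has_gamma_dist Y a2 b2 ->
  P (~` [set w | 0 < X w /\ 0 < Y w]) = 0.
Proof.
move=> Xg Yg.
have -> : ~` [set w | 0 < X w /\ 0 < Y w] = (X @^-1` `]-oo, 0]) `|` (Y @^-1` `]-oo, 0]).
  apply/seteqP; split => w /=; rewrite !in_itv/= !leNgt.
    by case: (0 < X w) => /= h; [right; apply/negP => y0; apply: h|left].
  by move=> [/negP h [] //|/negP h []].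
have mm (Z : {RV P >-> R}) : measurable (Z @^-1` `]-oo, 0%R]).
  by rewrite -[_ @^-1` _]setTI; exact: (measurable_funPT Z measurableT _ (measurable_itv _)).
by rewrite measureU0//; [exact: gamma_dist_le0 Xg|exact: gamma_dist_le0 Yg].
Qed.

Lemma mean_T_stat X Y a1 a2 k1 k2 nu : 0 < a1 -> 0 < a2 -> 0 < k1 -> 0 < k2 -> k1 != k2 ->
  1 < a1 + a2 -> - a2 < nu < a1 -> nu != 0 ->
  has_gamma_dist X a1 (a1 / k1) -> has_gamma_dist Y a2 (a2 / k2) -> independent_RV X Y ->
  (\int[P]_w (T_stat a1 a2 nu (X w) (Y w))%:E = ((1 - (k2 / k1) `^ nu) / (k1 - k2))%:E)%E.
Proof.
move=> a10 a20 k10 k20 k12 a12 nu12 nu0 Xg Yg XY; have /andP[nu1 nu2] := nu12.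
have h0 : - a2 < 0 < a1 by rewrite a10 oppr_lt0 a20.
have a0 : 0 < a1 - nu by lra.
have c0 : 0 < a2 + nu by lra.
pose C := Gamma_pos a1 * Gamma_pos a2 * (a1 - 1 - nu) / (Gamma_pos (a1 - nu) * Gamma_pos (a2 + nu)).
have G1 := Gamma_pos_gt0 a10; have G2 := Gamma_pos_gt0 a20.
have G3 := Gamma_pos_gt0 a0; have G4 := Gamma_pos_gt0 c0.
(* [S] stands for p^a1 q^(2 - a1), common to both means; after the subtraction only the terms in (k2
   / k1)^0 and (k2 / k1)^nu remain. *)
have key J0 J1 S :
    (a1 - 1 - 0) * J0 = Gamma_pos (a1 - 0) * Gamma_pos (a2 + 0) / (Gamma_pos a1 * Gamma_pos a2)
      * ((S - a1 / k1 * (a1 / k2) * (k2 / k1) `^ 0) / (a1 / k1 - a1 / k2)) ->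
    (a1 - 1 - nu) * J1 = Gamma_pos (a1 - nu) * Gamma_pos (a2 + nu) / (Gamma_pos a1 * Gamma_pos a2)
      * ((S - a1 / k1 * (a1 / k2) * (k2 / k1) `^ nu) / (a1 / k1 - a1 / k2)) ->
    a1^-1 * (a1 - 1) * J0 + - a1^-1 * C * J1 = (1 - (k2 / k1) `^ nu) / (k1 - k2).
  move=> J0E J1E.
  have pqE : a1 / k1 - a1 / k2 = a1 * (k2 - k1) / (k1 * k2) by field; rewrite !gt_eqF.
  have AJ : (a1 - 1) * J0 = (S - a1 / k1 * (a1 / k2)) / (a1 / k1 - a1 / k2).
    rewrite -[a1 - 1]subr0 J0E powRr0 mulr1 subr0 addr0 divff ?mul1r//.
    exact: mulf_neq0 (lt0r_neq0 G1) (lt0r_neq0 G2).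
  have CJ : C * J1 = (S - a1 / k1 * (a1 / k2) * (k2 / k1) `^ nu) / (a1 / k1 - a1 / k2).
    transitivity (Gamma_pos a1 * Gamma_pos a2 / (Gamma_pos (a1 - nu) * Gamma_pos (a2 + nu)) *
      ((a1 - 1 - nu) * J1)).
      rewrite /C; move: (Gamma_pos a1 * Gamma_pos a2) (Gamma_pos (a1 - nu) * Gamma_pos (a2 + nu))^-1 => A B.
      by ring.
    rewrite J1E mulrA -[RHS]mul1r; congr (_ * _).
    move: (Gamma_pos (a1 - nu)) (Gamma_pos (a2 + nu)) (Gamma_pos a1) (Gamma_pos a2) G1 G2 G3 G4 => A B D E D0 E0 A0 B0.
    by field; rewrite !gt_eqF.
  transitivity (a1^-1 * ((a1 - 1) * J0 - C * J1)).
    by rewrite mulNr mulNr -!mulrA -mulrBr.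
  rewrite AJ CJ pqE; move: ((k2 / k1) `^ nu) => Z.
  have k21 : k2 - k1 != 0 by rewrite subr_eq0 eq_sym.
  have k12' : k1 - k2 != 0 by rewrite subr_eq0.
  by field; rewrite k21 k12' !gt_eqF.
have [iU0 [J0 [U0E J0E]]] := mean_ratio a10 a20 k10 k20 k12 a12 h0 Xg Yg XY.
have [iU1 [J1 [U1E J1E]]] := mean_ratio a10 a20 k10 k20 k12 a12 nu12 Xg Yg XY.
set U0 := (fun w => ratio_fun _ _ _ _ _) in iU0.
set U1 := (fun w => ratio_fun _ _ _ _ _) in iU1.
transitivity (\int[P]_w ((a1^-1 * (a1 - 1))%:E * (U0 w)%:E + (- a1^-1 * C)%:E * (U1 w)%:E))%E.
  (* [T_value] describes the statistic only where both observations are positive, that is, almost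
     surely. *)
  apply: (eq_integral_ae (measurable_pos_pair X Y) (gamma_pair_pos Xg Yg)) => w [/= x0 y0].
  rewrite T_statE// /T_value /U0 /U1 /ratio_fun x0 y0 /= -!EFinM -EFinD; congr EFin.
  rewrite (_ : a2 * Y w / X w / a1 = a2 / a1 * (Y w / X w)); last by field; rewrite !gt_eqF.
  rewrite powRr0 addr0 (powR_inv1 (ltW x0)) -/C.
  move: (a2 / a1 * (Y w / X w)) => z.
  move: (hyp_value _ _ z) (hyp_value _ _ z) (z `^ nu) (C) => H1 H2 Z D.
  by field; rewrite !gt_eqF.
have {}key := key _ _ _ J0E J1E; rewrite -{}key {J0E J1E}.
change (\int[P]_w (U0 w)%:E = J0%:E)%E in U0E; change (\int[P]_w (U1 w)%:E = J1%:E)%E in U1E.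
clearbody U0 U1 C.
rewrite integralD; [|exact: measurableT|exact: integrableZl|exact: integrableZl].
rewrite !integralZl; [|exact: measurableT|exact: iU1|exact: measurableT|exact: iU0].
by rewrite U0E U1E.
Qed.

End Expectation.

(** * Quantiles and the F-distribution *)

Section Quantile.
Context {R : realType} d (T : measurableType d) (P : probability T R).

(** Right continuity at the infimum q gives F q >= p. Conversely no x < q satisfies p <= F x, so P(X
    < q) <= p as a limit from the left, and the absence of an atom at q yields F q <= p. *)
Lemma cdf_quantile (X : {RV P >-> R}) (F : R -> R) p : 0 < p < 1 ->
  (forall x, cdf X x = (F x)%:E) -> (forall x, P (X @^-1` [set x]) = 0%E) ->
  F (inf [set x | p <= F x]) = p.
Proof.
move=> /andP[p0 p1] XF X1; set A := [set x | _]; set q := inf A.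
have FE : F = fine \o cdf X by apply/funext => x /=; rewrite XF.
have F_nd x y : x <= y -> F x <= F y.
  by move=> xy; rewrite -lee_fin -!XF; exact: cdf_nondecreasing.
have mX (D : set R) : measurable D -> measurable (X @^-1` D).
  by move=> mD; rewrite -[_ @^-1` _]setTI; exact: (measurable_funPT X measurableT _ mD).
have A0 : A !=set0.
  have Fy : F x @[x --> +oo] --> (1 : R) by rewrite FE; exact/fine_cvg/cvg_cdfy1.
  have [x px] := filter_ex (cvgr_gt 1 Fy p p1).
  by exists x; exact: ltW.
have Alb : has_lbound A.
  have Fy : F x @[x --> -oo] --> (0 : R) by rewrite FE; exact/fine_cvg/cvg_cdfNy0.
  have [x px] := filter_ex (cvgr_lt 0 Fy p p0).
  exists x => y /= py; rewrite leNgt; apply/negP => yx.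
  by have := le_lt_trans (le_trans py (F_nd _ _ (ltW yx))) px; rewrite ltxx.
apply/eqP; rewrite eq_le; apply/andP; split; last first.
  rewrite leNgt; apply/negP => Fqp.
  have Fq : F x @[x --> q^'+] --> F q.
    by rewrite FE /=; apply: fine_cvg; rewrite /= fineK ?XF//; rewrite -XF; exact: cdf_right_continuous.
  have pf : ProperFilter q^'+ := at_right_proper_filter q.
  have : \forall x \near q^'+, F x < p /\ q < x.
    by apply: filterI; [exact: cvgr_lt Fq _ Fqp|exact: nbhs_right_gt].
  move=> /filter_ex[x [xp qx]].
  have [y py yx] := inf_lt A0 qx.
  by have := le_lt_trans (le_trans py (F_nd _ _ (ltW yx))) xp; rewrite ltxx.
pose B n := X @^-1` `]-oo, q - n.+1%:R^-1].
have BE : \bigcup_n B n = X @^-1` `]-oo, q[.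
  apply/seteqP; split => w.
    move=> [n _]; rewrite /B /= !in_itv/= => h; apply: le_lt_trans h _.
    by rewrite ltrBlDr ltrDl invr_gt0.
  rewrite /= in_itv/= => /ltr_add_invr[n h]; exists n => //.
  by rewrite /B /= in_itv/= lerBrDr ltW.
have mB n : measurable (B n) by exact: (mX _ (measurable_itv _)).
have mq : measurable (X @^-1` `]-oo, q[) by exact: (mX _ (measurable_itv _)).
have Bnd : nondecreasing_seq B.
  move=> m n mn; apply/subsetPset => w; rewrite /B /= !in_itv/= => /le_trans; apply.
  by rewrite lerD2l lerN2 lef_pV2 ?posrE// ler_nat ltnS.
have cB : (P \o B) @ \oo --> P (X @^-1` `]-oo, q[).
  by rewrite -BE; apply: nondecreasing_cvg_mu => //; rewrite BE.
rewrite -lee_fin -XF /cdf /distribution /pushforward.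
have -> : X @^-1` `]-oo, q] = X @^-1` `]-oo, q[ `|` X @^-1` [set q].
  apply/seteqP; split => w /=; rewrite !in_itv/= le_eqVlt.
    by move=> /orP[/eqP|]; [right|left].
  by move=> [->|->]; rewrite ?eqxx ?orbT.
rewrite measureU0//; last exact: X1.
suff : (limn (P \o B) <= p%:E)%E by rewrite (cvg_lim _ cB).
apply: lime_le; first by apply/cvg_ex; eexists; exact: cB.
apply: nearW => n; have := XF (q - n.+1%:R^-1).
rewrite /cdf /distribution /pushforward /= => ->; rewrite lee_fin leNgt.
apply/negP => /ltW pF; have := ge_inf Alb pF; rewrite -/q.
by rewrite leNgt ltrBlDr ltrDl invr_gt0 ltr0n.
Qed.

Lemma eq_measure_ae (E A B : set T) : measurable E -> P (~` E) = 0%E ->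
  measurable A -> measurable B -> (forall w, E w -> A w <-> B w) -> P A = P B.
Proof.
move=> mE E0 mA mB AB; rewrite -[A]setIT -[B]setIT -!integral_indic//.
apply: (eq_integral_ae mE E0) => w Ew; rewrite !indicE; congr ((_ : bool)%:R%:E).
by apply/idP/idP => /set_mem h; apply/mem_set/(AB w Ew).
Qed.

End Quantile.

(** * The pivot and its F-distribution *)

Section FisherRatio.
Context {R : realType} d (T : measurableType d) (P : probability T R).
Local Notation mu := (@lebesgue_measure R).
Local Notation Rp := (`]0%R, +oo[%classic : set R).
#[local] Opaque powR Gamma_pos.

Variables (X Y : {RV P >-> R}) (a1 a2 k1 k2 : R).
Hypotheses (a10 : 0 < a1) (a20 : 0 < a2) (k10 : 0 < k1) (k20 : 0 < k2).
Hypotheses (Xg : has_gamma_dist X a1 (a1 / k1)) (Yg : has_gamma_dist Y a2 (a2 / k2)).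
Hypothesis XY : independent_RV X Y.

(** With X = Y1 and Y = Y2 this is the pivot zeta Y1 / Y2: [ratio_fun] takes the denominator
    first. *)
Definition fisher_ratio w := ratio_fun 0 (k2 / k1) id (Y w) (X w).

Let YX : independent_RV Y X.
Proof. by move=> A B mA mB; rewrite setIC XY// muleC. Qed.

Lemma measurable_fisher_ratio : measurable_fun [set: T] fisher_ratio.
Proof.
by apply: measurable_ratio_RV; [exact: divr_gt0|exact: measurable_id].
Qed.

(** The probability of [A] is the mean of the indicator of [A] at the ratio, so [integral_ratio_fun]
    with j = 0 yields the density. *)
Lemma fisher_ratio_dist (A : set R) : measurable A ->
  P (fisher_ratio @^-1` A) = (\int[mu]_(x in A) (fisher_pdf (2 * a1) (2 * a2) x)%:E)%E.
Proof.
move=> mA.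
have mW : measurable (fisher_ratio @^-1` A).
  by rewrite -[_ @^-1` _]setTI; exact: (measurable_fisher_ratio measurableT mA).
rewrite -[fisher_ratio @^-1` A]setIT -integral_indic//.
have rho0 : 0 < k2 / k1 by exact: divr_gt0.
transitivity (\int[P]_w (ratio_fun 0 (k2 / k1) (\1_A : R -> R) (Y w) (X w))%:E)%E.
  apply: (eq_integral_ae (measurable_pos_pair Y X) (gamma_pair_pos Yg Xg)) => w [/= x0 y0].
  have wE : fisher_ratio w = k2 / k1 * (X w / Y w).
    by rewrite /fisher_ratio /ratio_fun x0 y0 /= oppr0 powRr0 mul1r.
  rewrite /ratio_fun x0 y0 /= oppr0 powRr0 mul1r -wE !indicE.
  by congr ((_ : bool)%:R%:E); apply/idP/idP => /set_mem h; exact/mem_set.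
have s0 : 0 < a2 + a1 - 0 by rewrite subr0 addr_gt0.
have b10 : 0 < a1 / k1 by exact: divr_gt0.
have b20 : 0 < a2 / k2 by exact: divr_gt0.
have mI : measurable_fun Rp (\1_A : R -> R) by exact/measurable_funTS/measurable_indic.
have I0 (z : R) : 0 < z -> 0 <= (\1_A z : R) by rewrite indicE.
rewrite (integral_ratio_fun a20 a10 b20 b10 rho0 s0 Yg Xg YX mI I0) subr0.
have Gs := Gamma_pos_gt0 (addr_gt0 a20 a10).
have G1 := Gamma_pos_gt0 a10; have G2 := Gamma_pos_gt0 a20.
rewrite -ge0_RintegralZl; last 4 first.
- exact: measurable_itv.
- apply: measurable_funM => //; apply: measurable_funM; last exact: measurable_affine_powR.
  by apply: measurable_funTS; exact: measurable_powR.
- by move=> z; rewrite /= in_itv/= andbT => z0; rewrite !mulr_ge0 ?powR_ge0 ?I0.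
- apply: mulr_ge0; last exact: powR_ge0.
  apply: divr_ge0; last exact: mulr_ge0 (ltW G2) (ltW G1).
  by apply: mulr_ge0 (ltW Gs); apply: mulr_ge0; exact: powR_ge0.
rewrite integral_mkcond [RHS]integral_mkcond; apply: eq_integral => z _.
rewrite !patchE; case: (boolP (z \in A)) => zA; last first.
  by case: ifPn => // _; rewrite indicE (negbTE zA) mul0r mulr0.
case: ifPn => [/set_mem|]; last first.
  rewrite notin_setE /= in_itv/= andbT => /negP z0.
  by rewrite /fisher_pdf (negbTE z0).
rewrite /= in_itv/= andbT => z0; rewrite indicE zA mul1r /fisher_pdf z0.
rewrite (_ : 2 * a1 / 2 = a1); last by field.
rewrite (_ : 2 * a2 / 2 = a2); last by field.
rewrite (_ : (2 * a1 + 2 * a2) / 2 = a2 + a1); last by field.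
rewrite (_ : 2 * a1 / (2 * a2) = a1 / a2); last by field; rewrite gt_eqF.
rewrite !GammaE ?addr_gt0//; congr EFin.
(* The scale k2 / k1 of the pivot brings out the common rate a2 / k2, after which both kappas
   cancel. *)
have h : a2 / k2 + z * (a1 / k1 / (k2 / k1)) = (a2 / k2) * (1 + a1 / a2 * z).
  by field; rewrite !gt_eqF.
have z10 : 0 <= 1 + a1 / a2 * z by rewrite addr_ge0// mulr_ge0 ?divr_ge0// ltW.
rewrite h (powRM _ (ltW b20) z10).
have -> : a1 / k1 = (a2 / k2) * (a1 / a2) * (k2 / k1) by field; rewrite !gt_eqF.
have r0 : 0 < a1 / a2 by exact: divr_gt0.
rewrite (powRM _ (mulr_ge0 (ltW b20) (ltW r0)) (ltW rho0)) (powRM _ (ltW b20) (ltW r0)).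
rewrite (_ : (a2 / k2) `^ (- (a2 + a1)) = ((a2 / k2) `^ a2 * (a2 / k2) `^ a1)^-1); last first.
  by rewrite powRN gt0_powRD.
rewrite [(k2 / k1) `^ (- a1)]powRN.
have := powR_gt0 a1 rho0; have := powR_gt0 a1 b20; have := powR_gt0 a2 b20.
move: ((k2 / k1) `^ a1) ((a2 / k2) `^ a1) ((a2 / k2) `^ a2) => A1 A2 A3 A30 A20 A10.
move: (z `^ (a1 - 1)) ((a1 / a2) `^ a1) ((1 + a1 / a2 * z) `^ (- (a2 + a1))) => B1 B2 B3.
move: (Gamma_pos (a2 + a1)) (Gamma_pos a1) (Gamma_pos a2) G1 G2 => C1 C2 C3 C20 C30.
by field; rewrite !gt_eqF.
Qed.

Let W : {RV P >-> R} := HB.pack fisher_ratio (isMeasurableFun.Build _ _ _ _ _ measurable_fisher_ratio).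

Lemma fisher_ratio_atomless x : P (fisher_ratio @^-1` [set x]) = 0%E.
Proof. by rewrite fisher_ratio_dist// integral_set1. Qed.

Lemma cdf_fisher_ratio x : P (fisher_ratio @^-1` `]-oo, x]) = (fisher_cdf (2 * a1) (2 * a2) x)%:E.
Proof.
rewrite /fisher_cdf /Rintegral -fisher_ratio_dist; last exact: measurable_itv.
rewrite fineK// fin_num_measure//.
by rewrite -[_ @^-1` _]setTI; exact: (measurable_fisher_ratio measurableT (measurable_itv _)).
Qed.

Lemma fisher_cdf_quantile p : 0 < p < 1 ->
  fisher_cdf (2 * a1) (2 * a2) (fisher_quantile (2 * a1) (2 * a2) p) = p.
Proof.
move=> p01; apply: (@cdf_quantile _ _ _ _ W) => //.
- exact: cdf_fisher_ratio.
- exact: fisher_ratio_atomless.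
Qed.

(** The distribution function vanishes at 0 and equals p > 0 at the quantile. A positive quantile
    makes Z positive, so that powers of Z and zeta can be compared through their bases. *)
Lemma fisher_quantile_gt0 p : 0 < p < 1 -> 0 < fisher_quantile (2 * a1) (2 * a2) p.
Proof.
move=> p01; rewrite ltNge; apply/negP => q0.
have F0 : fisher_cdf (2 * a1) (2 * a2) 0 = 0.
  rewrite /fisher_cdf /Rintegral integral0_eq// => x; rewrite /= in_itv/= => x0.
  by rewrite /fisher_pdf ltNge x0.
have : (cdf W (fisher_quantile (2 * a1) (2 * a2) p) <= cdf W 0)%E by exact: cdf_nondecreasing.
rewrite /cdf /distribution /pushforward /= !cdf_fisher_ratio F0 fisher_cdf_quantile// lee_fin.
by rewrite leNgt; case/andP: p01 => ->.
Qed.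

Lemma fisher_ratio_le p : 0 < p < 1 ->
  P (fisher_ratio @^-1` `]-oo, fisher_quantile (2 * a1) (2 * a2) p]) = p%:E.
Proof. by move=> p01; rewrite cdf_fisher_ratio fisher_cdf_quantile. Qed.

Lemma fisher_ratio_ge p : 0 < p < 1 ->
  P (fisher_ratio @^-1` `[fisher_quantile (2 * a1) (2 * a2) p, +oo[) = (1 - p)%:E.
Proof.
move=> p01; set q := fisher_quantile _ _ _.
have mW (D : set R) : measurable D -> measurable (fisher_ratio @^-1` D).
  by move=> mD; rewrite -[_ @^-1` _]setTI; exact: (measurable_fisher_ratio measurableT mD).
(* The endpoint belongs to the event but has probability 0, so the complement rule applies to the
   open half-line. *)
have -> : `[q, +oo[%classic = [set q] `|` `]q, +oo[%classic.
  by rewrite setU1itv.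
rewrite preimage_setU setUC measureU0; last 3 first.
- exact: (mW _ (measurable_itv _)).
- exact: (mW _ (measurable_set1 _)).
- exact: fisher_ratio_atomless.
have -> : fisher_ratio @^-1` `]q, +oo[ = ~` (fisher_ratio @^-1` `]-oo, q]).
  by rewrite preimage_setC setCitvl.
transitivity (1 - P (fisher_ratio @^-1` `]-oo, q]))%E.
  exact: (probability_setC P (mW _ (measurable_itv _))).
by rewrite fisher_ratio_le.
Qed.

End FisherRatio.

(** * Coverage of the confidence set *)

Lemma measurable_inv (R : realType) : measurable_fun [set: R] (@GRing.inv R).
Proof.
(* The power with exponent -1 inverts nonnegative arguments, so it is applied to x^2; at x = 0 both
   sides are 0. *)
rewrite (_ : @GRing.inv R = fun x : R => x * (x * x) `^ (- 1)).
  by apply: measurable_funM => //; apply: (measurableT_comp (measurable_powR _)); exact: measurable_funM.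
apply/funext => x; have [->|x0] := eqVneq x 0; first by rewrite invr0 mul0r.
have xx : 0 <= x * x by rewrite -expr2 sqr_ge0.
by rewrite powR_inv1// invfM mulrA divff// mul1r.
Qed.

Lemma gt0_ler_powRE (R : realType) (r x y : R) : 0 < r -> 0 < x -> 0 < y ->
  (x `^ r <= y `^ r) = (x <= y).
Proof.
move=> r0 x0 y0; have := le_mono_in (gt0_ltr_powR r0).
by apply; rewrite nnegrE ltW.
Qed.

Theorem theorem12 (R : realType) (d : measure_display) (T : measurableType d)
    (P : probability T R) (Y1 Y2 : {RV P >-> R})
    (alpha1 alpha2 kappa1 kappa2 alpha nu : R)
    (alpha1_gt0 : 0 < alpha1) (alpha2_gt0 : 0 < alpha2)
    (kappa1_gt0 : 0 < kappa1) (kappa2_gt0 : 0 < kappa2)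
    (Y1_gamma : has_gamma_dist Y1 alpha1 (alpha1 / kappa1))
    (Y2_gamma : has_gamma_dist Y2 alpha2 (alpha2 / kappa2))
    (Y_indep : independent_RV Y1 Y2)
    (alpha_itv : 0 < alpha < 1)
    (nu_itv : - alpha2 < nu < alpha1) (nu_neq0 : nu != 0)
    (tau_defined : kappa1 != kappa2)
    (alpha_sum_gt1 : 1 < alpha1 + alpha2) :
  let tau := (kappa1 - kappa2)^-1 in
  let T_nu := fun w => T_stat alpha1 alpha2 nu (Y1 w) (Y2 w) in
  P [set w | CI_ARB alpha alpha1 alpha2 nu (Y1 w) (Y2 w) (ARB P T_nu tau)]
  = (1 - alpha)%:E.
Proof.
move=> tau T_nu.
have z0 : 0 < kappa2 / kappa1 by exact: divr_gt0.
have k12 : kappa1 - kappa2 != 0 by rewrite subr_eq0.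
have -> : ARB P T_nu tau = (kappa2 / kappa1) `^ nu.
  have M := mean_T_stat alpha1_gt0 alpha2_gt0 kappa1_gt0 kappa2_gt0 tau_defined
    alpha_sum_gt1 nu_itv nu_neq0 Y1_gamma Y2_gamma Y_indep.
  rewrite /ARB unlock M /tau /=.
  rewrite (_ : (_ - _) / _ = - (kappa2 / kappa1) `^ nu); last by field.
  by rewrite normrN ger0_norm ?powR_ge0.
set zeta := kappa2 / kappa1 in z0 *.
have zE : zeta = kappa2 / kappa1 by [].
clearbody zeta.
have zn0 : 0 < zeta `^ nu by exact: powR_gt0.
have mE := measurable_pos_pair Y1 Y2; have E0 := gamma_pair_pos Y1_gamma Y2_gamma.
have mW := measurable_fisher_ratio Y1 Y2 kappa1_gt0 kappa2_gt0.
have mWp (D : set R) : measurable D ->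
    measurable (fisher_ratio Y1 Y2 kappa1 kappa2 @^-1` D).
  by move=> mD; rewrite -[_ @^-1` _]setTI; exact: (mW measurableT D mD).
(* The coverage event will be compared with an event on the pivot off a null set, for which it has
   to be measurable. Its lower condition 0 < zeta^nu always holds. *)
have mCI (q : R) : measurable [set w | `]0, (Y2 w / Y1 w * q) `^ nu]%classic (zeta `^ nu)].
  pose Q w := (Y2 w / Y1 w * q) `^ nu.
  have mQ : measurable_fun [set: T] Q.
    apply: (measurableT_comp (measurable_powR nu)); apply: measurable_funM => //.
    apply: measurable_funM; first exact: measurable_funPT.
    exact: (measurableT_comp (@measurable_inv R) (measurable_funPT Y1)).
  have := mQ measurableT `[zeta `^ nu, +oo[%classic (measurable_itv _); rewrite setTI.
  congr measurable; apply/seteqP; split => w; rewrite /= !in_itv/= andbT ?zn0//.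
have a'01 : 0 < 1 - alpha < 1 by lra.
rewrite /CI_ARB /Z_stat /F_upper; have [nu_lt0|nu_ge0] := ltP nu 0.
  (* The upper quantile taken at 1 - alpha is the quantile of level alpha, and the pivot is at least
     that large with probability 1 - alpha. *)
  rewrite (_ : 1 - (1 - alpha) = alpha); last by ring.
  rewrite -(fisher_ratio_ge alpha1_gt0 alpha2_gt0 kappa1_gt0 kappa2_gt0 Y1_gamma Y2_gamma Y_indep alpha_itv).
  have := fisher_quantile_gt0 alpha1_gt0 alpha2_gt0 kappa1_gt0 kappa2_gt0 Y1_gamma Y2_gamma Y_indep alpha_itv.
  move: (fisher_quantile _ _ _) => q q0.
  apply: (eq_measure_ae mE E0); [exact: mCI|exact: (mWp _ (measurable_itv _))|] => w [/= x0 y0].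
  rewrite !in_itv/= andbT zn0 /= /fisher_ratio /ratio_fun x0 y0 /= oppr0 powRr0 mul1r -zE.
  have r0 : 0 < Y2 w / Y1 w * q by rewrite mulr_gt0// divr_gt0.
  (* The negative exponent reverses the comparison, which is why the upper tail of the pivot
     appears. *)
  have -> : (zeta `^ nu <= (Y2 w / Y1 w * q) `^ nu) = (Y2 w / Y1 w * q <= zeta).
    rewrite -[nu]opprK [zeta `^ _]powRN [_ `^ (- - nu)]powRN lef_pV2 ?posrE ?powR_gt0//.
    by apply: gt0_ler_powRE; rewrite ?oppr_gt0.
  by rewrite mulrAC ler_pdivrMr// [zeta * (_ / _)]mulrA ler_pdivlMr// [q * _]mulrC.
rewrite -(fisher_ratio_le alpha1_gt0 alpha2_gt0 kappa1_gt0 kappa2_gt0 Y1_gamma Y2_gamma Y_indep a'01).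
have := fisher_quantile_gt0 alpha1_gt0 alpha2_gt0 kappa1_gt0 kappa2_gt0 Y1_gamma Y2_gamma Y_indep a'01.
move: (fisher_quantile _ _ _) => q q0.
apply: (eq_measure_ae mE E0); [exact: mCI|exact: (mWp _ (measurable_itv _))|] => w [/= x0 y0].
rewrite !in_itv/= zn0 /= /fisher_ratio /ratio_fun x0 y0 /= oppr0 powRr0 mul1r -zE.
have r0 : 0 < Y2 w / Y1 w * q by rewrite mulr_gt0// divr_gt0.
have nu_gt0 : 0 < nu by rewrite lt_neqAle eq_sym nu_neq0.
rewrite (gt0_ler_powRE nu_gt0 z0 r0).
by rewrite mulrAC ler_pdivlMr// [zeta * (_ / _)]mulrA ler_pdivrMr// [q * _]mulrC.
Qed.
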